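(* Let $c_+,c_->0$, $\beta>0$, and let $B_\beta=\{B_\beta(t),t\ge 0\}$ be a self-similar process with index $\beta$ and càdlàg trajectories. Let $\alpha$ satisfy $\alpha+\beta^{-1}>1$. Assume that 1. there exists a unique weak solution $X$ to the equation $$X(t)=\int_0^t \bigl(c_+\mathbf 1_{X(s)\geq 0} -c_-\mathbf 1_{X(s)< 0}\bigr)|X(s)|^\alpha\, ds + B_\beta(t),\quad t\geq 0;$$ 2. $\mathrm P\left(\lim_{t\to\infty}|X(t)|=\infty\right)=1$; 3. either (a) $\alpha\in(0,1)$ and there exist a function $h$ with $h(t)=o(t^{\frac1{1-\alpha}})$, $t\to\infty$, and a random sequence $\{t_n\}$ with $\lim_{n\to\infty}t_n=\infty$ such that $|B_\beta(t)-B_\beta(t_n)|\le h(t-t_n)$ for all $t\ge t_n$ (and all $n$), a.s.; or (b) $\alpha\in(-1,0]$ and $B_\beta(t)=o(t^{\frac1{1-\alpha}})$, $t\to\infty$, a.s. For $\varepsilon>0$ let $X_\varepsilon$ be a solution of $$X_\varepsilon(t)=\int_0^t \bigl(c_+\mathbf 1_{X_\varepsilon(s)\geq 0} -c_-\mathbf 1_{X_\varepsilon(s)< 0}\bigr)|X_\varepsilon(s)|^\alpha\, ds + \varepsilon B_\beta(t),\quad t\geq 0.$$ Then, as $\varepsilon\to0+$, the distributions of the processes $X_\varepsilon$ converge weakly in $D([0,\infty))$ to the distribution of the process $$t\mapsto ((1-\alpha)t)^{\frac{1}{1-\alpha}}\left(c_+^{\frac{1}{1-\alpha}}\mathbf 1_{\{\lim_{s\to\infty}X(s)=+\infty\}}-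 c_-^{\frac{1}{1-\alpha}}\mathbf 1_{\{\lim_{s\to\infty}X(s)=-\infty\}}\right),\quad t\ge 0.$$
   Context: A process $B_\beta$ is self-similar with index $\beta>0$ if for every $a>0$ the processes $\{B_\beta(at),t\ge0\}$ and $\{a^\beta B_\beta(t),t\ge0\}$ have the same distribution. All processes considered have càdlàg trajectories. For $\varepsilon>0$, a weak solution to the equation $$Y(t)=\int_0^t \bigl(c_+\mathbf 1_{Y(s)\geq 0} -c_-\mathbf 1_{Y(s)< 0}\bigr)|Y(s)|^\alpha\, ds + \varepsilon B_\beta(t),\quad t\geq 0$$ (the equation for $X_\varepsilon$ when $Y=X_\varepsilon$, and the equation for $X$ when $Y=X$ and $\varepsilon=1$), is a pair of adapted processes $(\tilde X,\tilde B_\beta)$ on a filtered probability space $(\Omega,\mathcal F,\mathrm P,\{\mathcal F_t,t\ge0\})$ such that $(\tilde X,\tilde B_\beta)$, in place of $(Y,B_\beta)$, satisfies this equation a.s. and $\tilde B_\beta\overset{d}{=}B_\beta$; the tildes are then omitted and all processes are considered on the corresponding probability space. If $B_\beta$ is a Lévy process, $\tilde B_\beta$ is moreover required to be an $\mathcal F_t$-Lévy process; if $B_\beta$ is a fractional Brownian motion, $\tilde B_\beta$ is required to be an $\mathcal F_t$-fractional Brownian motion (i.e. the Brownian motion associated with it by the canonical Volterra kernel representation is an $\mathcal F_t$-Brownian motion). Weak uniqueness means that all weak solutions have the same distribution. $D([0,\infty))$ is the Skorokhod space of càdlàg functions. *)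

(* Defs.v *)
From HB Require Import structures.
From mathcomp Require Import all_boot all_order all_algebra.
From mathcomp Require Import all_classical all_reals all_analysis.

Set Implicit Arguments.
Unset Strict Implicit.
Unset Printing Implicit Defensive.

Import Order.TTheory GRing.Theory Num.Theory.
Import numFieldNormedType.Exports.

Local Open Scope classical_set_scope.
Local Open Scope ring_scope.

(* What [f =o_F g] of landau.v unfolds to for [F] the filter [+oo], which has
   no canonical [filter_on] structure. *)
Definition littleo_pinfty (R : realType) (f g : R -> R) : Prop :=
  forall eps : R, 0 < eps -> \forall t \near +oo, `|f t| <= eps * `|g t|.

(** * The Skorokhod space D([0, oo)) *)

Definition cadlag (R : realType) (f : R -> R) : Prop :=
  (forall t, 0 <= t -> f s @[s --> t^'+] --> f t) /\
  (forall t, 0 < t -> cvg (f s @[s --> t^'-])).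

(* A cadlag function on [0, oo) is represented by its extension by 0 to
   the negative reals, so that the representation is one-to-one. *)
Record skorokhod (R : realType) := Skorokhod {
  skorokhod_fun :> R -> R ;
  skorokhod_cadlag : cadlag skorokhod_fun ;
  skorokhod_neg : forall t, t < 0 -> skorokhod_fun t = 0 }.

HB.instance Definition _ (R : realType) := gen_eqMixin (skorokhod R).
HB.instance Definition _ (R : realType) := gen_choiceMixin (skorokhod R).

Definition time_change (R : realType) (l : R -> R) : Prop :=
  set_bij `[0, +oo[ `[0, +oo[ l /\
  {in `[0, +oo[ &, {homo l : x y / x < y}}.

(* [f_n --> f] in Skorokhod's J1 topology iff, for all [M] and [e > 0], [f_n]
   is eventually in [skorokhod_nbhd f M e] (Jacod and Shiryaev, VI.1.14). *)
Definition skorokhod_nbhd (R : realType) (f : skorokhod R) (M e : R) :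
    set (skorokhod R) :=
  [set g | exists l : R -> R, [/\ time_change l,
     (forall s, 0 <= s -> `|l s - s| < e) &
     (forall s, 0 <= s <= M -> `|g (l s) - f s| < e)]].

Definition skorokhod_open (R : realType) (U : set (skorokhod R)) : Prop :=
  forall f, U f -> exists M e : R, 0 < e /\ skorokhod_nbhd f M e `<=` U.

Lemma skorokhod_openT (R : realType) : skorokhod_open [set: skorokhod R].
Proof. by move=> f _; exists 0, 1; split. Qed.

Lemma skorokhod_openI (R : realType) : setI_closed (@skorokhod_open R).
Proof.
move=> U V oU oV f [Uf Vf].
have [M1 [e1 [e1_gt0 sU]]] := oU f Uf.
have [M2 [e2 [e2_gt0 sV]]] := oV f Vf.
exists (Num.max M1 M2), (Num.min e1 e2); split; first by rewrite lt_min e1_gt0.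
move=> g [l [lP l_id gl]]; split; [apply: sU | apply: sV];
  exists l; split=> // s.
- by move=> /l_id; rewrite lt_min => /andP[].
- move=> /andP[s0 sM]; have : 0 <= s <= Num.max M1 M2 by rewrite s0 le_max sM.
  by move=> /gl; rewrite lt_min => /andP[].
- by move=> /l_id; rewrite lt_min => /andP[].
- move=> /andP[s0 sM].
  have : 0 <= s <= Num.max M1 M2 by rewrite s0 le_max sM orbT.
  by move=> /gl; rewrite lt_min => /andP[].
Qed.

Lemma skorokhod_open_bigU (R : realType) (I : Type)
    (U : I -> set (skorokhod R)) :
  (forall i, skorokhod_open (U i)) -> skorokhod_open (\bigcup_i U i).
Proof.
move=> oU f [i _ Uif]; have [M [e [e_gt0 sU]]] := oU i f Uif.
by exists M, e; split=> // g /sU Uig; exists i.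
Qed.

HB.instance Definition _ (R : realType) :=
  isOpenTopological.Build (skorokhod R)
    (@skorokhod_openT R) (@skorokhod_openI R) (@skorokhod_open_bigU R).

(** * Laws of processes *)

(* The generators of the product sigma-algebra on [I -> R]. *)
Definition coordinate_sets (I : Type) (R : realType) : set (set (I -> R)) :=
  [set C | exists i (A : set R), measurable A /\ C = [set x | A (x i)]].

Definition same_law (I : Type) (R : realType)
    (d : measure_display) (T : measurableType d) (P : probability T R)
    (d' : measure_display) (T' : measurableType d') (P' : probability T' R)
    (X : I -> T -> R) (X' : I -> T' -> R) : Prop :=
  forall C : set (I -> R), <<s @coordinate_sets I R >> C ->
    P [set w | C (X^~ w)] = P' [set w | C (X'^~ w)].

Definition process (R : realType) (d : measure_display) (T : measurableType d)
    (X : T -> skorokhod R) : Prop :=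
  forall t, 0 <= t -> measurable_fun setT (fun w => X w t).

Definition self_similar (R : realType) (d : measure_display)
    (T : measurableType d) (P : probability T R) (b : R)
    (B : T -> skorokhod R) : Prop :=
  forall a : R, 0 < a ->
    same_law P P (fun t w => B w (a * t)) (fun t w => a `^ b * B w t).

(* The distributions of [X' e] (each possibly on its own probability space)
   converge weakly in D([0, oo)) to the distribution of [X] as [e --> 0+]. *)
Definition weak_cvg_at0 (R : realType)
    (d' : R -> measure_display) (T' : forall e : R, measurableType (d' e))
    (P' : forall e : R, probability (T' e) R)
    (X' : forall e : R, T' e -> skorokhod R)
    (d : measure_display) (T : measurableType d) (P : probability T R)
    (X : T -> skorokhod R) : Prop :=
  forall G : skorokhod R -> R, continuous G -> bounded_fun G ->
    ('E_(P' e)[G \o X' e] @[e --> 0^'+] --> 'E_P[G \o X])%E.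

(** * Filtrations *)

Definition filtration (R : realType) (d : measure_display)
    (T : measurableType d) (F : R -> set_system T) : Prop :=
  [/\ forall t, 0 <= t -> sigma_algebra setT (F t),
      forall t, 0 <= t -> F t `<=` measurable &
      forall s t, 0 <= s -> s <= t -> F s `<=` F t].

Definition adapted (R : realType) (T : Type) (F : R -> set_system T)
    (X : T -> R -> R) : Prop :=
  forall t, 0 <= t -> forall A : set R, measurable A ->
    F t [set w | A (X w t)].

Definition natural_filtration (R : realType) (T : Type) (X : T -> R -> R)
    (t : R) : set_system T :=
  <<s [set E | exists s (A : set R),
         [/\ 0 <= s <= t, measurable A & E = [set w | A (X w s)]] ] >>.

Definition increments_indep_of_past (R : realType) (d : measure_display)
    (T : measurableType d) (P : probability T R) (F : R -> set_system T)
    (X : T -> R -> R) : Prop :=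
  forall s t, 0 <= s -> s <= t -> forall (A : set R) (E : set T),
    measurable A -> F s E ->
    P ([set w | A (X w t - X w s)] `&` E) =
    (P [set w | A (X w t - X w s)%R] * P E)%E.

(** * Levy processes *)

Definition F_levy (R : realType) (d : measure_display) (T : measurableType d)
    (P : probability T R) (F : R -> set_system T) (B : T -> skorokhod R) :
    Prop :=
  [/\ adapted F B,
      {ae P, forall w, B w 0 = 0},
      increments_indep_of_past P F B &
      forall s t, 0 <= s -> s <= t -> forall A : set R, measurable A ->
        P [set w | A (B w t - B w s)] = P [set w | A (B w (t - s))]].

Definition levy (R : realType) (d : measure_display) (T : measurableType d)
    (P : probability T R) (B : T -> skorokhod R) : Prop :=
  F_levy P (natural_filtration B) B.

(** * Brownian and fractional Brownian motions *)

(* [normal_prob m 0] is not the Dirac mass at [m], whence the case split. *)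
Definition has_normal_law (R : realType) (d : measure_display)
    (T : measurableType d) (P : probability T R) (m sigma : R) (Z : T -> R) :
    Prop :=
  forall A : set R, measurable A ->
    P (Z @^-1` A) =
    if sigma == 0 then dirac m A else normal_prob m sigma A.

Definition F_brownian (R : realType) (d : measure_display)
    (T : measurableType d) (P : probability T R) (F : R -> set_system T)
    (W : T -> R -> R) : Prop :=
  [/\ adapted F W,
      {ae P, forall w, W w 0 = 0},
      {ae P, forall w, {within `[0, +oo[, continuous (W w)}},
      increments_indep_of_past P F W &
      forall s t, 0 <= s -> s <= t ->
        has_normal_law P 0 (Num.sqrt (t - s)) (fun w => W w t - W w s)].

Definition fractional_brownian (R : realType) (d : measure_display)
    (T : measurableType d) (P : probability T R) (H : R)
    (B : T -> skorokhod R) : Prop :=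
  [/\ 0 < H < 1,
      forall (n : nat) (a t : 'I_n -> R), (forall i, 0 <= t i) ->
        exists m sigma : R,
          has_normal_law P m sigma (fun w => \sum_(i < n) a i * B w (t i)),
      forall t, 0 <= t -> ('E_P[fun w => B w t] = 0)%E &
      forall s t, 0 <= s -> 0 <= t ->
        ('E_P[fun w => (B w s * B w t)%R])%E =
        ((s `^ (2 * H) + t `^ (2 * H) - `|t - s| `^ (2 * H)) / 2)%:E].

Definition euler_beta (R : realType) (a b : R) : R :=
  \int[@lebesgue_measure R]_(x in `[0, 1]) (x `^ (a - 1) * (1 - x) `^ (b - 1)).

(* The Volterra kernel of the Molchan-Golosov representation
   [B^H(t) = \int_0^t K_H(t, s) dW(s)], for [0 < s < t]
   (Nualart, The Malliavin Calculus and Related Topics, section 5.1.3). *)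
Definition volterra_kernel (R : realType) (H t s : R) : R :=
  if H == 1 / 2 then 1
  else if 1 / 2 < H then
    Num.sqrt (H * (2 * H - 1) / euler_beta (2 - 2 * H) (H - 1 / 2)) *
    (s `^ (1 / 2 - H) *
     \int[@lebesgue_measure R]_(u in `[s, t])
       ((u - s) `^ (H - 3 / 2) * u `^ (H - 1 / 2)))
  else
    Num.sqrt (2 * H / ((1 - 2 * H) * euler_beta (1 - 2 * H) (H + 1 / 2))) *
    ((t / s) `^ (H - 1 / 2) * (t - s) `^ (H - 1 / 2) -
     (H - 1 / 2) * s `^ (1 / 2 - H) *
     \int[@lebesgue_measure R]_(u in `[s, t])
       (u `^ (H - 3 / 2) * (u - s) `^ (H - 1 / 2))).

Definition step_fun (R : realType) (n : nat) (p a : nat -> R) (s : R) : R :=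
  \sum_(i < n) a i * \1_(`]p i, p i.+1]) s.

Definition step_integral (R : realType) (n : nat) (p a : nat -> R)
    (x : R -> R) : R :=
  \sum_(i < n) a i * (x (p i.+1) - x (p i)).

(* [Z] is the Wiener integral of the deterministic function [f] over [0, t]
   with respect to the Brownian motion [W]: the L2-limit of the integrals of
   step functions converging to [f] in L2([0, t]). *)
Definition is_wiener_integral (R : realType) (d : measure_display)
    (T : measurableType d) (P : probability T R) (W : T -> R -> R)
    (t : R) (f : R -> R) (Z : T -> R) : Prop :=
  exists (n : nat -> nat) (p a : nat -> nat -> R),
    [/\ forall k i j, (i <= j <= n k)%N -> 0 <= p k i /\ p k i <= p k j <= t,
        (\int[@lebesgue_measure R]_(s in `[0%R, t])
           ((step_fun (n k) (p k) (a k) s - f s) ^+ 2)%:E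
           @[k --> \oo] --> 0)%E &
        ('E_P[fun w => ((step_integral (n k) (p k) (a k) (W w) - Z w) ^+ 2)%R]
           @[k --> \oo] --> 0)%E].

Definition F_fractional_brownian (R : realType) (d : measure_display)
    (T : measurableType d) (P : probability T R) (F : R -> set_system T)
    (H : R) (B : T -> skorokhod R) : Prop :=
  fractional_brownian P H B /\
  exists W : T -> R -> R, F_brownian P F W /\
    forall t, 0 <= t ->
      is_wiener_integral P W t (volterra_kernel H t) (fun w => B w t).

(** * The equation *)

(* [powR] gives the value 0 to negative powers of 0. *)
Definition abs_pow (R : realType) (alpha x : R) : \bar R :=
  if (x == 0) && (alpha < 0) then +oo%E else (`|x| `^ alpha)%:E.

Definition drift (R : realType) (cp cm alpha x : R) : \bar R :=
  ((cp * \1_[set y : R | (0 <= y)%R] x - cm * \1_[set y : R | (y < 0)%R] x)%:E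
   * abs_pow alpha x)%E.

Definition solves (R : realType) (cp cm alpha eps : R) (x b : R -> R) : Prop :=
  forall t, 0 <= t ->
    (@lebesgue_measure R).-integrable `[0, t]
      (fun s => drift cp cm alpha (x s)) /\
    ((x t)%:E = \int[@lebesgue_measure R]_(s in `[0%R, t])
                  drift cp cm alpha (x s) + (eps * b t)%:E)%E.

(* The noise [B] of the solution is required to have the law of the process
   [B0] given on the probability space ([T0], [P0]). *)
Definition weak_solution (R : realType) (cp cm alpha eps : R)
    (d0 : measure_display) (T0 : measurableType d0) (P0 : probability T0 R)
    (B0 : T0 -> skorokhod R)
    (d : measure_display) (T : measurableType d) (P : probability T R)
    (F : R -> set_system T) (X B : T -> skorokhod R) : Prop :=
  [/\ [/\ filtration F, adapted F X & adapted F B],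
      {ae P, forall w, solves cp cm alpha eps (X w) (B w)},
      same_law P P0 (fun t w => B w t) (fun t w => B0 w t),
      levy P0 B0 -> F_levy P F B &
      forall H, fractional_brownian P0 H B0 -> F_fractional_brownian P F H B].

Definition pair_process (R : realType) (T : Type) (X B : T -> skorokhod R)
    (i : R + R) (w : T) : R :=
  match i with inl t => X w t | inr t => B w t end.

Definition weak_uniqueness (R : realType) (cp cm alpha eps : R)
    (d0 : measure_display) (T0 : measurableType d0) (P0 : probability T0 R)
    (B0 : T0 -> skorokhod R) : Prop :=
  forall (d1 : measure_display) (T1 : measurableType d1)
         (P1 : probability T1 R) (F1 : R -> set_system T1)
         (X1 B1 : T1 -> skorokhod R)
         (d2 : measure_display) (T2 : measurableType d2)
         (P2 : probability T2 R) (F2 : R -> set_system T2)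
         (X2 B2 : T2 -> skorokhod R),
    weak_solution cp cm alpha eps P0 B0 P1 F1 X1 B1 ->
    weak_solution cp cm alpha eps P0 B0 P2 F2 X2 B2 ->
    same_law P1 P2 (pair_process X1 B1) (pair_process X2 B2).

(* Main.v *)
Require Import Defs.
From HB Require Import structures.
From mathcomp Require Import all_boot all_order all_algebra.
From mathcomp Require Import all_classical all_reals all_analysis.
From mathcomp Require Import measurable_realfun ring lra.

Set Implicit Arguments.
Unset Strict Implicit.
Unset Printing Implicit Defensive.

Import Order.TTheory GRing.Theory Num.Theory.
Import numFieldNormedType.Exports.

Local Open Scope classical_set_scope.
Local Open Scope ring_scope.

(** Let [gam = 1 / (1 - alpha)]. The drift is homogeneous of degree [alpha] and
    the noise is self-similar, so that, by weak uniqueness, the solution with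
    noise of size [e] has the law of [t |-> lam * X (t / lam ^ (1 - alpha))], where
    [lam = e ^ (1 / (1 - (1 - alpha) * beta))] ([weak_solution_rescale],
    [expectation_small_noise]). The assumption on [alpha] and [beta] says that
    [lam] tends to 0 with [e]: the limit of small noise is the limit of large
    times for the single process [X].

    It thus suffices that, almost surely, [X t / t ^ gam] tends to the coefficient
    of one of the two extremal solutions of the equation without noise if [X]
    tends to [+oo] or to [-oo], and to 0 otherwise ([path_asymptotics]): as
    [t ^ gam] is invariant under the rescaling, the rescaled paths then converge
    uniformly on compact sets ([asymptotic_to_rescaled]), and dominated
    convergence gives the weak convergence.

    These asymptotics hold path by path. If [alpha > 0], the drift increases with
    the distance to 0; once the path is far from 0 at a time after which the noise
    is negligible, it keeps its sign and stays above every curve [a * t ^ gam]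
    with a coefficient [a] smaller than the extremal one, and below a curve with a
    larger coefficient, by a first exit argument ([growth_lower],
    [growth_upper]). If [alpha <= 0], the drift decreases with the distance to 0
    and pulls a path of constant sign towards the extremal curve
    ([asymptotic_sublinear]). In that case jumps may change the sign of the path
    for ever, although its absolute value tends to infinity; but then the integral
    of the drift never reaches a curve [eta * t ^ gam], past which it could not
    come back, and the path is [o(t ^ gam)] ([asymptotic_oscillating]), which
    agrees with a limit path equal to 0.

    Two ingredients concern laws. A continuous functional on the Skorokhod space
    is measurable for the sigma-algebra of the coordinates, whence its expectation
    depends only on the finite-dimensional laws
    ([measurable_continuous_functional]); this rests on the approximation of a
    cadlag path by step paths on a grid, after a small change of time
    ([grid_time_change]). And a rescaled solution is a weak solution, which for
    a fractional Brownian noise requires that its Hurst index be [beta]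
    ([fractional_self_similar_index]) and that the Volterra kernel be homogeneous
    ([volterra_kernel_dilation]). *)

(** * Cadlag paths and their approximation in the Skorokhod topology *)

Section right_left_limits.
Variable R : realType.
Implicit Types (x : R -> R) (e t : R).

Lemma cvg_at_right_ltP x t l e : x s @[s --> t^'+] --> l -> 0 < e ->
  exists2 r, 0 < r & forall s, t < s < t + r -> `|x s - l| < e.
Proof.
move=> /cvgrPdist_lt xl e0; have [r /= r0 rP] := xl _ e0.
exists r => // s /andP[ts sr]; rewrite distrC; apply: rP => //=.
by rewrite ltr_distlC; apply/andP; split; lra.
Qed.

Lemma cvg_at_left_ltP x t l e : x s @[s --> t^'-] --> l -> 0 < e ->
  exists2 r, 0 < r & forall s, t - r < s < t -> `|x s - l| < e.
Proof.
move=> /cvgrPdist_lt xl e0; have [r /= r0 rP] := xl _ e0.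
exists r => // s /andP[ts sr]; rewrite distrC; apply: rP => //=.
by rewrite ltr_distlC; apply/andP; split; lra.
Qed.

Lemma cvg_at_rightPlt x t l : (forall e, 0 < e ->
    exists2 r, 0 < r & forall s, t < s < t + r -> `|x s - l| < e) ->
  x s @[s --> t^'+] --> l.
Proof.
move=> H; apply/cvgrPdist_lt => e e0; have [r r0 rP] := H _ e0.
exists r => //= s /=; rewrite ltr_distlC => /andP[_ s2] ts.
by rewrite distrC; apply: rP; rewrite ts s2.
Qed.

Lemma cvg_at_leftPlt x t l : (forall e, 0 < e ->
    exists2 r, 0 < r & forall s, t - r < s < t -> `|x s - l| < e) ->
  x s @[s --> t^'-] --> l.
Proof.
move=> H; apply/cvgrPdist_lt => e e0; have [r r0 rP] := H _ e0.
exists r => //= s /=; rewrite ltr_distlC => /andP[s2 _] ts.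
by rewrite distrC; apply: rP; rewrite ts s2.
Qed.

End right_left_limits.

Section partitions.
Variable R : realType.
Implicit Types (x : R -> R) (T e s t : R).

(** [T] is the last node of a subdivision of [0, T] on whose half-open cells
    [x] oscillates by less than [e]. *)
Inductive partitionable x e : R -> Prop :=
| partitionable0 : partitionable x e 0
| partitionable_step T1 T2 : partitionable x e T1 -> 0 <= T1 -> T1 < T2 ->
    (forall s u, T1 <= s < T2 -> T1 <= u < T2 -> `|x s - x u| < e) ->
    partitionable x e T2.

(** The supremum [m] of the reachable nodes is reachable because [x] has a left
    limit at [m], and a node beyond [m] is reachable because [x] is
    right-continuous at [m]; hence [m] is [T]. *)
Lemma cadlag_partitionable x e T : cadlag x -> 0 < e -> 0 <= T ->
  partitionable x e T.
Proof.
move=> [xr xl] e0 T0.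
pose A := [set S | 0 <= S <= T /\ partitionable x e S].
have A0 : A 0 by split; [rewrite lexx T0 | exact: partitionable0].
have supA : has_sup A.
  by split; [exists 0 | exists T => S [] /andP[]].
pose m := sup A.
have m0 : 0 <= m by exact: ub_le_sup supA.2 _ A0.
have mT : m <= T by apply: ge_sup => [|S [] /andP[]//]; exists 0.
have e20 : 0 < e / 2 by rewrite divr_gt0.
have pm : partitionable x e m.
  have [m_gt0|] := ltP 0 m; last first.
    move=> m_le0; have -> : m = 0 by apply/le_anti; rewrite m_le0.
    exact: partitionable0.
  have [r r0 rP] := cvg_at_left_ltP (xl m m_gt0) e20.
  have [S [/andP[S0 ST] pS] Sm] := sup_adherent r0 supA.
  have SM : S <= m by apply: (ub_le_sup supA.2); split; rewrite ?S0.
  move: SM; rewrite le_eqVlt => /orP[/eqP<-//|SM].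
  apply: (partitionable_step pS) => // s u /andP[s1 s2] /andP[u1 u2].
  have := rP s; have := rP u.
  rewrite (lt_le_trans Sm s1) (lt_le_trans Sm u1) s2 u2.
  move=> /(_ isT) + /(_ isT); rewrite !ltr_distl => /andP[? ?] /andP[? ?].
  by apply/andP; split; lra.
have [m_lt|] := ltP m T; last by move=> Tm; have -> : T = m by apply/le_anti; rewrite Tm.
have [r r0 rP] := cvg_at_right_ltP (xr m m0) e20.
pose S := Num.min T (m + r).
have mS : m < S by rewrite lt_min m_lt ltrDl.
have pS : partitionable x e S.
  apply: (partitionable_step pm) => //.
  have rP' s : m <= s < S -> `|x s - x m| < e / 2.
    rewrite le_eqVlt => /andP[/orP[/eqP<- _|ms]]; first by rewrite subrr normr0.
    by rewrite lt_min => /andP[_ sr]; apply: rP; rewrite ms.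
  move=> s u /rP' + /rP'; rewrite !ltr_distl => /andP[? ?] /andP[? ?].
  by apply/andP; split; lra.
suff : S <= m by rewrite leNgt mS.
apply: (ub_le_sup supA.2); split=> //; rewrite (le_trans m0 (ltW mS)) /=.
by rewrite ge_min lexx.
Qed.

Lemma cadlag_bounded x T : cadlag x -> exists C, forall s, 0 <= s <= T -> `|x s| <= C.
Proof.
move=> cx; have [T0|T0] := ltP T 0.
  by exists 0 => s /andP[s0 sT]; have := le_trans s0 sT; rewrite leNgt T0.
have := cadlag_partitionable cx ltr01 T0; elim=> {T0 T}.
  by exists `|x 0| => s s0; have <- : 0 = s by exact: le_anti.
move=> T1 T2 _ [C CP] T10 T12 osc.
exists (C + 1 + `|x T1| + `|x T2|) => s /andP[s0 sT].
have C0 : 0 <= C by apply: le_trans (CP 0 _); rewrite // lexx T10.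
have n1 : 0 <= `|x T1| by []. have n2 : 0 <= `|x T2| by [].
have [sT1|sT1] := leP s T1.
  by have := CP s; rewrite s0 sT1 => /(_ isT); lra.
move: sT; rewrite le_eqVlt => /orP[/eqP ->|sT]; first by lra.
have := osc s T1; rewrite (ltW sT1) sT lexx T12 => /(_ isT isT).
by have := lerB_dist (x s) (x T1); lra.
Qed.

End partitions.

Section grid.
Variable R : realType.
Implicit Types (x : R -> R) (T e s t : R) (v : nat -> R) (N : nat).

Lemma nat_ceil_ex (y : R) : 0 <= y -> exists k : nat, y <= k%:R < y + 1.
Proof.
move=> y0; have /andP[ky yk] := truncn_itv y0.
have [ey|/negP ny] := boolP (y == (Num.truncn y)%:R).
  by exists (Num.truncn y); rewrite -(eqP ey) lexx ltrDl ltr01.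
exists (Num.truncn y).+1; rewrite (ltW yk) -natr1 ltrD2r lt_neqAle ky andbT.
by apply/negP => /eqP H; apply: ny; rewrite H.
Qed.

Definition affine_interp (T1 K1 T2 K2 s : R) :=
  K1 + (s - T1) / (T2 - T1) * (K2 - K1).

Lemma affine_interpE (T1 K1 T2 K2 s : R) : T1 < T2 -> T1 <= s <= T2 ->
  exists2 a : R, 0 <= a <= 1 &
    s = T1 + a * (T2 - T1) /\ affine_interp T1 K1 T2 K2 s = K1 + a * (K2 - K1).
Proof.
move=> T12 /andP[s1 s2]; exists ((s - T1) / (T2 - T1)); last first.
  split=> //; rewrite divfK; first by lra.
  by rewrite subr_eq0 gt_eqF.
apply/andP; split; first by rewrite divr_ge0 ?subr_ge0 // ltW.
by rewrite ler_pdivrMr ?subr_gt0 // mul1r lerD2r.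
Qed.

Lemma affine_interp_incr (T1 K1 T2 K2 s t : R) : T1 < T2 -> K1 < K2 -> s < t ->
  affine_interp T1 K1 T2 K2 s < affine_interp T1 K1 T2 K2 t.
Proof.
move=> T12 K12 st; rewrite ltrD2l ltr_pM2r ?subr_gt0 // ltr_pM2r ?ltrD2r //.
by rewrite invr_gt0 subr_gt0.
Qed.

Lemma affine_interp_l (T1 K1 T2 K2 : R) : affine_interp T1 K1 T2 K2 T1 = K1.
Proof. by rewrite /affine_interp subrr mul0r mul0r addr0. Qed.

Lemma affine_interp_r (T1 K1 T2 K2 : R) : T1 < T2 ->
  affine_interp T1 K1 T2 K2 T2 = K2.
Proof.
move=> T12; rewrite /affine_interp divff ?mul1r; first by lra.
by rewrite subr_eq0 gt_eqF.
Qed.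

Lemma affine_interpK (T1 K1 T2 K2 s : R) : T1 < T2 -> K1 < K2 ->
  affine_interp T1 K1 T2 K2 (affine_interp K1 T1 K2 T2 s) = s.
Proof.
move=> T12 K12; rewrite /affine_interp.
have ? : T2 - T1 != 0 by rewrite subr_eq0 gt_eqF.
have ? : K2 - K1 != 0 by rewrite subr_eq0 gt_eqF.
by field; apply/andP.
Qed.

Definition grid_floor N s : R := (Num.truncn (N.+1%:R * s))%:R / N.+1%:R.

(** Each node [T_i] of the subdivision is moved up to the next point of the grid,
    and the time change is affine in between. The grid point below the image of
    [s] then lies in the same cell of the subdivision as [s], since the point of
    the grid preceding the image of [T_i] is smaller than [T_i]; this is where
    rounding up, rather than down, matters. *)
Lemma grid_time_change x e T : partitionable x e T -> 0 <= T ->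
  \forall N \near \oo, exists (l : R -> R) (k : nat),
   [/\ l 0 = 0 /\ l T = k%:R / N.+1%:R,
       forall s t, 0 <= s -> s < t -> t <= T -> l s < l t,
       forall y, 0 <= y <= l T -> exists2 s, 0 <= s <= T & l s = y,
       forall s, 0 <= s <= T -> s <= l s <= s + N.+1%:R^-1 &
       forall s, 0 <= s < T -> `|x (grid_floor N (l s)) - x s| < e].
Proof.
elim=> {T} [_|T1 T2 _ IH T10 T12 osc T20].
  exists 0%N => // N _; exists id, 0%N; split=> //.
  - by rewrite mul0r.
  - by move=> y /= y0; exists y.
  - by move=> s /andP[s0 _]; rewrite lexx lerDl invr_ge0 ler0n.
  - by move=> s /andP[s0 /(le_lt_trans s0)]; rewrite ltxx.
have {}IH := IH T10.
(* Distinct nodes must be moved to distinct points of the grid. *)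
have mesh : \forall N \near \oo, 1 < N.+1%:R * (T2 - T1).
  have [k /andP[kT _]] : exists k : nat, (T2 - T1)^-1 <= k%:R < (T2 - T1)^-1 + 1.
    by apply: nat_ceil_ex; rewrite invr_ge0 subr_ge0 ltW.
  exists k => // N /= kN; rewrite -ltr_pdivrMr ?subr_gt0 // div1r.
  by rewrite (le_lt_trans kT) // ltr_nat.
near=> N.
have [l [k1 [[l0 lT1] linc lsurj lid lx]]] : exists (l : R -> R) (k : nat),
   [/\ l 0 = 0 /\ l T1 = k%:R / N.+1%:R,
       forall s t, 0 <= s -> s < t -> t <= T1 -> l s < l t,
       forall y, 0 <= y <= l T1 -> exists2 s, 0 <= s <= T1 & l s = y,
       forall s, 0 <= s <= T1 -> s <= l s <= s + N.+1%:R^-1 &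
       forall s, 0 <= s < T1 -> `|x (grid_floor N (l s)) - x s| < e].
  by near: N; exact: IH.
have meshN : 1 < N.+1%:R * (T2 - T1) by near: N.
set n : R := N.+1%:R in lT1 lid meshN *.
have n0 : 0 < n by rewrite ltr0n.
have nV0 : 0 < n^-1 by rewrite invr_gt0.
have nVn : n * n^-1 = 1 by rewrite divff ?gt_eqF.
have [k2 /andP[k2l k2u]] : exists k : nat, n * T2 <= k%:R < n * T2 + 1.
  by apply: nat_ceil_ex; rewrite mulr_ge0 // ltW.
pose K1 := l T1; pose K2 := k2%:R / n.
have /andP[K1l K1u] : T1 <= K1 <= T1 + n^-1 by apply: lid; rewrite T10 lexx.
have nK1 : n * K1 = k1%:R by rewrite /K1 lT1 mulrC divfK ?gt_eqF.
have nK2 : n * K2 = k2%:R by rewrite /K2 mulrC divfK ?gt_eqF.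
have /andP[K2l K2u] : T2 <= K2 <= T2 + n^-1.
  rewrite -(ler_pM2l n0) -[X in _ && X](ler_pM2l n0) mulrDr nVn nK2.
  by rewrite k2l ltW.
have K12 : K1 < K2.
  have : n^-1 < T2 - T1 by rewrite -(ltr_pM2l n0) nVn.
  by move=> nT; apply: (le_lt_trans K1u); apply: lt_le_trans K2l; rewrite addrC -ltrBrDr.
have K2E : K2 = k2%:R / n by [].
clearbody K2; pose m s := if s <= T1 then l s else affine_interp T1 K1 T2 K2 s.
have m_le s : s <= T1 -> m s = l s by rewrite /m => ->.
have m_ge s : T1 <= s -> m s = affine_interp T1 K1 T2 K2 s.
  rewrite /m => Ts; case: leP => // sT; have -> : s = T1 by apply/le_anti/andP.
  by rewrite affine_interp_l.
have mT2 : m T2 = K2 by rewrite m_ge ?ltW // affine_interp_r.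
exists m, k2; split.
- by rewrite m_le // mT2 K2E.
- move=> s t s0 st tT.
  have [tT1|T1t] := leP t T1; first by rewrite !m_le ?(le_trans (ltW st)) //; apply: linc.
  have [sT1|T1s] := leP s T1; last by rewrite !m_ge ?ltW //; exact: affine_interp_incr.
  rewrite m_le // (m_ge t) ?ltW //; apply: (@le_lt_trans _ _ K1).
    move: sT1; rewrite le_eqVlt => /orP[/eqP->//|sT1]; apply/ltW/linc => //.
  by rewrite -{1}(affine_interp_l T1 K1 T2 K2); apply: affine_interp_incr.
- move=> y /andP[y0]; rewrite mT2 => yK2.
  have [yK1|K1y] := leP y K1.
    have [s /andP[s0 sT] lsy] : exists2 s, 0 <= s <= T1 & l s = y.
      by apply: lsurj; rewrite y0.
    by exists s; rewrite ?m_le // s0 (le_trans sT) ?ltW.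
  have yK : K1 <= y <= K2 by rewrite ltW.
  have [a /andP[a0 a1] [ya sa]] := affine_interpE T1 T2 K12 yK.
  have T1s : T1 <= affine_interp K1 T1 K2 T2 y by rewrite sa; nra.
  have sT2 : affine_interp K1 T1 K2 T2 y <= T2 by rewrite sa; nra.
  exists (affine_interp K1 T1 K2 T2 y); first by rewrite sT2 (le_trans T10).
  by rewrite m_ge // affine_interpK.
- move=> s /andP[s0 sT2]; have [sT1|T1s] := leP s T1.
    by rewrite m_le //; apply: lid; rewrite s0.
  rewrite (m_ge _ (ltW T1s)).
  have sT : T1 <= s <= T2 by rewrite ltW.
  have [a /andP[a0 a1] [sE aE]] := affine_interpE K1 K2 T12 sT.
  rewrite aE sE.
  have b0 : 0 <= 1 - a by rewrite subr_ge0.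
  have p1 : 0 <= (1 - a) * (K1 - T1) by rewrite mulr_ge0 ?subr_ge0.
  have p2 : 0 <= a * (K2 - T2) by rewrite mulr_ge0 ?subr_ge0.
  have p3 : 0 <= (1 - a) * (T1 + n^-1 - K1) by rewrite mulr_ge0 ?subr_ge0.
  have p4 : 0 <= a * (T2 + n^-1 - K2) by rewrite mulr_ge0 ?subr_ge0.
  clear -p1 p2 p3 p4; move: (n^-1) p3 p4 => d p3 p4.
  by apply/andP; split; nra.
- move=> s /andP[s0 sT2]; have [sT1|T1s] := ltP s T1.
    by rewrite m_le ?ltW //; apply: lx; rewrite s0.
  rewrite m_ge //.
  set y := affine_interp _ _ _ _ _.
  have K1y : K1 <= y.
    rewrite -(affine_interp_l T1 K1 T2 K2) /y.
    move: T1s; rewrite le_eqVlt => /orP[/eqP->//|T1s].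
    exact/ltW/affine_interp_incr.
  have yK2 : y < K2 by rewrite -(affine_interp_r K1 K2 T12); apply: affine_interp_incr.
  have ny0 : 0 <= n * y by rewrite mulr_ge0 ?(ltW n0) // (le_trans _ K1y) // (le_trans _ K1l).
  apply: osc; last by rewrite T1s.
  rewrite /grid_floor -/n ler_pdivlMr // ltr_pdivrMr //.
  apply/andP; split.
    apply: (@le_trans _ _ k1%:R); first by rewrite -nK1 mulrC ler_pM2l.
    by rewrite ler_nat truncn_ge_nat // -nK1 ler_pM2l.
  have : (Num.truncn (n * y) < k2)%N by rewrite truncn_lt_nat // -nK2 ltr_pM2l.
  by rewrite -(ler_nat R) -natr1 mulrC; move: k2u; lra.
Unshelve. all: by end_near.
Qed.

End grid.

Section grid_paths.
Variable R : realType.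
Implicit Types (x : R -> R) (T e s t : R) (v : nat -> R) (N : nat).

Definition grid_fun N v t : R :=
  if t < 0 then 0 else v (Num.truncn (N.+1%:R * t)).

Lemma grid_funE N v t : 0 <= t -> grid_fun N v t = v (Num.truncn (N.+1%:R * t)).
Proof. by rewrite /grid_fun leNgt => /negbTE ->. Qed.

Lemma grid_fun_cadlag N v : cadlag (grid_fun N v).
Proof.
have n0 : 0 < N.+1%:R :> R by rewrite ltr0n.
split=> t t0.
  apply: cvg_at_rightPlt => e e0; rewrite (grid_funE _ _ t0).
  have nt0 : 0 <= N.+1%:R * t by rewrite mulr_ge0.
  have /andP[k1 k2] := truncn_itv nt0.
  exists ((Num.truncn (N.+1%:R * t)).+1%:R / N.+1%:R - t).
    by rewrite subr_gt0 ltr_pdivlMr // mulrC.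
  move=> s /andP[ts]; rewrite addrC subrK ltr_pdivlMr // => sk.
  rewrite (grid_funE _ _ (le_trans t0 (ltW ts))) (_ : Num.truncn _ = Num.truncn (N.+1%:R * t)).
    by rewrite subrr normr0.
  apply: truncn_def; rewrite [_ * s]mulrC sk andbT (le_trans k1) //.
  by rewrite [leRHS]mulrC ler_pM2l // ltW.
have [k /andP[k1 k2]] : exists k : nat, N.+1%:R * t <= k%:R < N.+1%:R * t + 1.
  by apply: nat_ceil_ex; rewrite mulr_ge0 ?ltW.
have k0 : (0 < k)%N by rewrite -(ltr_nat R) (lt_le_trans _ k1) // mulr_gt0.
apply/cvg_ex; exists (v k.-1); apply: cvg_at_leftPlt => e e0.
exists (t - k.-1%:R / N.+1%:R).
  rewrite subr_gt0 ltr_pdivrMr // mulrC -(ltrD2r 1) natr1 prednK //.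
move=> s /andP[]; rewrite subKr ltr_pdivrMr // mulrC => ks st.
have s0 : 0 <= s.
  by rewrite -(pmulr_rge0 _ n0) (le_trans _ (ltW ks)).
rewrite (grid_funE _ _ s0) (_ : Num.truncn _ = k.-1) ?subrr ?normr0 //.
by apply: truncn_def; rewrite (ltW ks) prednK //= (lt_le_trans _ k1) // ltr_pM2l.
Qed.

Lemma grid_fun_neg N v t : t < 0 -> grid_fun N v t = 0.
Proof. by rewrite /grid_fun => ->. Qed.

Definition grid_path N v : skorokhod R :=
  Skorokhod (grid_fun_cadlag N v) (@grid_fun_neg N v).

(** The time change of [grid_time_change] on [0, |M| + 1], continued by a
    translation, brings the step path uniformly close to [f]. *)
Lemma grid_path_nbhd (f : skorokhod R) (M e : R) : 0 < e ->
  \forall N \near \oo, forall v,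
    (forall i, (i < N.+1 * N.+1)%N -> `|v i - f (i%:R / N.+1%:R)| <= N.+1%:R^-1) ->
    skorokhod_nbhd f M e (grid_path N v).
Proof.
move=> e0; have e20 : 0 < e / 2 by rewrite divr_gt0.
pose T := `|M| + 1.
have T0 : 0 <= T by rewrite addr_ge0.
have MT : M < T by rewrite (le_lt_trans (ler_norm M)) // ltrDl.
have pT := cadlag_partitionable (skorokhod_cadlag f) e20 T0.
have N_large (y : R) : \forall N \near \oo, y < N.+1%:R.
  have [k /andP[kT _]] : exists k : nat, `|y| <= k%:R < `|y| + 1 by exact: nat_ceil_ex.
  by exists k => // N /= kN; rewrite (le_lt_trans (ler_norm _)) // (le_lt_trans kT) // ltr_nat.
near=> N => v vf.
have [l [k [[l0 lT] linc lsurj lid lx]]] : exists (l : R -> R) (k : nat),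
   [/\ l 0 = 0 /\ l T = k%:R / N.+1%:R,
       forall s t, 0 <= s -> s < t -> t <= T -> l s < l t,
       forall y, 0 <= y <= l T -> exists2 s, 0 <= s <= T & l s = y,
       forall s, 0 <= s <= T -> s <= l s <= s + N.+1%:R^-1 &
       forall s, 0 <= s < T -> `|f (grid_floor N (l s)) - f s| < e / 2].
  by near: N; exact: grid_time_change.
have Ne : N.+1%:R^-1 < e / 2.
  rewrite -[ltRHS]invrK ltf_pV2 ?posrE ?invr_gt0 ?ltr0n //; near: N; exact: N_large.
have NT : T + 1 < N.+1%:R by near: N; exact: N_large.
have n0 : 0 < N.+1%:R :> R by rewrite ltr0n.
pose L s := if s <= T then l s else s + (l T - T).
have L_le s : s <= T -> L s = l s by rewrite /L => ->.
have L_ge s : T <= s -> L s = s + (l T - T).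
  rewrite /L => Ts; case: leP => // sT; have -> : s = T by apply/le_anti/andP.
  by rewrite addrC subrK.
have lidT : T <= l T <= T + N.+1%:R^-1 by apply: lid; rewrite T0 lexx.
have Lid s : 0 <= s -> s <= L s <= s + N.+1%:R^-1.
  move=> s0; have [sT|Ts] := leP s T; first by rewrite L_le //; apply: lid; rewrite s0.
  by rewrite (L_ge _ (ltW Ts)); move: (N.+1%:R^-1) lidT => d /andP[? ?]; apply/andP; split; lra.
have Linc s t : 0 <= s -> s < t -> L s < L t.
  move=> s0 st; have [tT|Tt] := leP t T.
    by rewrite !L_le ?(le_trans (ltW st)) //; exact: linc.
  have [sT|Ts] := ltP s T; last first.
    by rewrite (L_ge _ Ts) (L_ge _ (ltW Tt)) ltrD2r.
  rewrite (L_le s (ltW sT)) (L_ge t (ltW Tt)) (@lt_trans _ _ (l T)) //; first exact: linc.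
  by clear -Tt; lra.
exists L; split; last 2 first.
- move=> s /Lid; move: (N.+1%:R^-1) Ne => d ? /andP[? ?].
  by rewrite ltr_norml; apply/andP; split; lra.
- move=> s /andP[s0 sM]; have sT : s < T by exact: le_lt_trans MT.
  have /andP[Ls1 Ls2] := Lid s s0.
  rewrite /= (grid_funE _ _ (le_trans s0 Ls1)).
  set i := Num.truncn _.
  have nL0 : 0 <= N.+1%:R * L s by rewrite mulr_ge0 // (le_trans s0).
  have iN : (i < N.+1 * N.+1)%N.
    rewrite truncn_lt_nat // natrM ltr_pM2l // (le_lt_trans Ls2) //.
    have : N.+1%:R^-1 <= 1 :> R by rewrite invf_le1 // ler1n.
    by move=> n1; rewrite (le_lt_trans _ NT) // lerD // ltW.
  have := vf i iN; have := lx s; rewrite s0 sT -(L_le _ (ltW sT)) /grid_floor -/i => /(_ isT).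
  move: (N.+1%:R^-1) Ne => d ?.
  rewrite ltr_norml => /andP[? ?]; rewrite ler_norml => /andP[? ?].
  by rewrite ltr_norml; apply/andP; split; lra.
- split; last by move=> s t; rewrite !in_itv /= !andbT => s0 t0; exact: Linc.
  split.
  + move=> s /=; rewrite !in_itv /= !andbT => s0.
    by have /andP[+ _] := Lid s s0; exact: le_trans.
  + move=> s t; rewrite !inE /= !in_itv /= !andbT => s0 t0 Lst.
    by have [st|ts|//] := ltgtP s t; [have := Linc _ _ s0 st|have := Linc _ _ t0 ts];
      rewrite Lst ltxx.
  + move=> y /=; rewrite in_itv /= andbT => y0.
    have [yl|ly] := leP y (l T).
      have [|s /andP[s0 sT] <-] := lsurj y; first by rewrite y0.
      by exists s; rewrite ?L_le //= in_itv /= s0.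
    exists (y - (l T - T)) => /=.
      by rewrite in_itv /= andbT; clear -ly T0; lra.
    by rewrite L_ge; clear -ly; lra.
Unshelve. all: by end_near.
Qed.

(** The values of [f] on a grid, themselves rounded to multiples of
    [1 / N.+1]: as they form a finite sequence of integers, any function of
    them is measurable as soon as they are. *)
Definition quantize N (f : skorokhod R) : seq int :=
  [seq Num.floor (N.+1%:R * f (i%:R / N.+1%:R)) | i <- iota 0 (N.+1 * N.+1)].

Definition path_of_code N (s : seq int) : skorokhod R :=
  grid_path N (fun i => (nth 0 s i)%:~R / N.+1%:R).

Lemma path_of_quantize_nbhd (f : skorokhod R) (M e : R) : 0 < e ->
  \forall N \near \oo, skorokhod_nbhd f M e (path_of_code N (quantize N f)).
Proof.
move=> e0; apply: filterS (grid_path_nbhd f M e0) => N; apply => i iN.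
rewrite (nth_map 0%N) ?size_iota // nth_iota // add0n.
set y := f _; have n0 : 0 < N.+1%:R :> R by rewrite ltr0n.
have /andP[f1 f2] := floor_itv (N.+1%:R * y).
have ky : (Num.floor (N.+1%:R * y))%:~R / N.+1%:R <= y.
  by rewrite ler_pdivrMr // [leRHS]mulrC.
have yk : y - N.+1%:R^-1 <= (Num.floor (N.+1%:R * y))%:~R / N.+1%:R.
  rewrite ler_pdivlMr // mulrBl mulVf ?gt_eqF // lerBlDr [leLHS]mulrC -intrD1 ltW //.
have d0 : 0 <= N.+1%:R^-1 :> R by rewrite invr_ge0 ltW.
move: (N.+1%:R^-1) (_ / _) d0 ky yk => d z ? ? ?.
by rewrite ler_norml; apply/andP; split; lra.
Qed.

Lemma cvg_path_of_quantize (f : skorokhod R) :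
  path_of_code N (quantize N f) @[N --> \oo] --> f.
Proof.
move=> U; rewrite nbhsE => -[V [oV Vf] VU].
have [M [e [e0 MV]]] := oV f Vf.
by apply: filterS (path_of_quantize_nbhd f M e0) => N /MV /VU.
Qed.

End grid_paths.

(** * Laws on the path space *)

(** Measurable spaces are pointed; any path would do. *)
HB.instance Definition _ (R : realType) :=
  isPointed.Build (skorokhod R) (grid_path 0 (fun=> 0)).

Section path_space.
Variable R : realType.

Definition coordinate_cylinders : set_system (skorokhod R) :=
  [set U | exists t (A : set R), measurable A /\ U = [set x : skorokhod R | A (x t)]].

Definition path_space := g_sigma_algebraType coordinate_cylinders.

Lemma measurable_coordinate t :
  measurable_fun [set: path_space] (fun x : path_space => (x : skorokhod R) t).
Proof.
move=> _ A mA; rewrite setTI; apply: sub_sigma_algebra.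
by exists t, A.
Qed.

Lemma measurable_to_paths d (T : measurableType d) (X : T -> path_space) :
  (forall t, measurable_fun [set: T] (fun w => (X w : skorokhod R) t)) ->
  measurable_fun [set: T] X.
Proof.
move=> mX; apply: (@measurability _ _ _ _ setT X coordinate_cylinders) => //.
move=> _ [_ [t [A [mA ->]]] <-].
exact: mX.
Qed.

(** The preimages by [F \o q] are countable unions of fibers of [q]. *)
Lemma measurable_countable_comp d (T : measurableType d) (K : countType)
    d' (T' : measurableType d') (q : T -> K) (F : K -> T') :
  (forall k, measurable [set x | q x = k]) -> measurable_fun [set: T] (F \o q).
Proof.
move=> mq _ A mA; rewrite setTI.
rewrite (_ : _ @^-1` _ =
    \bigcup_k (if `[< A (F k) >] then [set x | q x = k] else set0)).
  by apply: countable_bigcupT_measurable => // k; case: ifP.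
apply/seteqP; split=> x /=.
  by move=> Ax; exists (q x) => //=; rewrite asboolT.
by case=> k _; case: ifP => // /asboolP AFk /= ->.
Qed.

Lemma measurable_seq_eq d (T : measurableType d) (I : Type) (f : I -> T -> int)
    (r : seq I) (s : seq int) :
  (forall i k, measurable [set x | f i x = k]) ->
  measurable [set x | [seq f i x | i <- r] = s].
Proof.
move=> mf; elim: r s => [|i r IH] [|k s] /=.
- by rewrite (_ : mkset _ = setT) //; apply/seteqP; split.
- by rewrite (_ : mkset _ = set0) //; apply/seteqP; split.
- by rewrite (_ : mkset _ = set0) //; apply/seteqP; split.
- rewrite (_ : mkset _ = [set x | f i x = k] `&` [set x | [seq f i x | i <- r] = s]).
    exact: measurableI.
  by apply/seteqP; split=> x /= [-> ->].
Qed.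

Lemma measurable_floor_eq d (T : measurableType d) (f : T -> R) (k : int) :
  measurable_fun setT f -> measurable [set x | Num.floor (f x) = k].
Proof.
move=> mf; rewrite (_ : mkset _ = setT `&` f @^-1` `[k%:~R, (k + 1)%:~R[%classic).
  exact: mf.
apply/seteqP; split=> x /=.
  by move=> <-; split=> //; rewrite in_itv /= floor_itv.
by case=> _; rewrite in_itv /=; exact: floor_def.
Qed.

(** The Borel sets of the Skorokhod topology are generated by the coordinates:
    [G x] is the limit of the values of [G] at the codes of [x], which range over
    a countable set and depend on finitely many coordinates of [x]. *)
Lemma measurable_continuous_functional (G : skorokhod R -> R) :
  continuous G -> measurable_fun [set: path_space] (G : path_space -> R).
Proof.
move=> cG.
apply: (@measurable_fun_cvg _ _ _ _
  (fun N (x : path_space) => G (path_of_code R N (quantize N x)))).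
  move=> N; apply: (@measurable_countable_comp _ _ _ _ _
    (fun x : path_space => quantize N x) (fun s => G (path_of_code R N s))) => s.
  apply: measurable_seq_eq => i k; apply: measurable_floor_eq.
  by apply: measurable_funM => //; exact: measurable_coordinate.
by move=> x _; apply: (cvg_comp _ _ (@cvg_path_of_quantize R x)); exact: cG.
Qed.

End path_space.

Section laws.
Variable R : realType.
Context d (T : measurableType d) (P : probability T R).
Context d' (T' : measurableType d') (P' : probability T' R).
Implicit Types (X : T -> skorokhod R).

Definition same_path_law X (X' : T' -> skorokhod R) :=
  forall U : set (path_space R), measurable U -> P (X @^-1` U) = P' (X' @^-1` U).

Lemma same_path_lawP X (X' : T' -> skorokhod R) :
  same_law P P' (fun t w => X w t) (fun t w => X' w t) <-> same_path_law X X'.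
Proof.
split=> [XX' U mU|XX' C mC].
  have [C mC <-] : preimage_set_system setT (@skorokhod_fun R)
      (<<s @coordinate_sets R R >>) U.
    apply: mU; split.
      exact/sigma_algebra_preimage/smallest_sigma_algebra.
    move=> _ [t [A [mA ->]]]; exists [set x | A (x t)]; last by rewrite setTI.
    by apply: sub_sigma_algebra; exists t, A.
  by rewrite setTI; exact: XX'.
apply: (XX' (@skorokhod_fun R @^-1` C)).
suff : image_set_system setT (@skorokhod_fun R)
    (@measurable _ (path_space R)) C by rewrite /image_set_system /= setTI.
move: C mC; apply: smallest_sub.
  exact/sigma_algebra_image/sigma_algebra_measurable.
move=> _ [t [A [mA ->]]]; rewrite /image_set_system /= setTI.
by apply: sub_sigma_algebra; exists t, A.
Qed.

Lemma same_path_law_comp (f : path_space R -> path_space R) X (X' : T' -> skorokhod R) :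
  measurable_fun setT f -> same_path_law X X' ->
  same_path_law (f \o X) (f \o X').
Proof.
move=> mf XX' U mU; apply: (XX' (f @^-1` U)).
by rewrite -[X in _ X]setTI; exact: mf.
Qed.

Lemma expectation_path_law (psi : path_space R -> R) X (X' : T' -> skorokhod R) :
  measurable_fun setT (X : T -> path_space R) ->
  measurable_fun setT (X' : T' -> path_space R) ->
  measurable_fun setT psi ->
  same_path_law X X' -> ('E_P[psi \o X] = 'E_P'[psi \o X'])%E.
Proof.
move=> mX mX' mpsi XX'; rewrite unlock.
have mpsiE : measurable_fun setT (EFin \o psi) by exact/measurable_EFinP.
have part (f : path_space R -> \bar R) : measurable_fun setT f ->
    (forall x, 0 <= f x)%E ->
    (\int[P]_w f (X w) = \int[P']_w f (X' w))%E.
  move=> mf f0.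
  rewrite -[LHS](ge0_integral_pushforward mX P measurableT mf) //.
  rewrite -[RHS](ge0_integral_pushforward mX' P' measurableT mf) //.
  by apply: eq_measure_integral => A mA _; exact: XX'.
change ((\int[P]_w ((EFin \o psi) \o X) w = \int[P']_w ((EFin \o psi) \o X') w)%E).
rewrite [LHS]integralE [RHS]integralE.
rewrite (funepos_comp (EFin \o psi) X) (funepos_comp (EFin \o psi) X').
rewrite (funeneg_comp (EFin \o psi) X) (funeneg_comp (EFin \o psi) X').
congr (_ - _)%E.
- exact: (part _ (measurable_funepos mpsiE)).
- exact: (part _ (measurable_funeneg mpsiE)).
Qed.

End laws.

(** * Dilations of the Lebesgue measure *)

Section dilation.
Variable R : realType.
Local Notation mu := (@lebesgue_measure R).
Local Notation dil := (fun c : R => ( *%R c : measurableTypeR R -> measurableTypeR R)).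
Implicit Types (c : R) (D : set R).

Lemma measurable_dilation c : measurable_fun [set: measurableTypeR R] (dil c).
Proof. exact: measurable_funM. Qed.

Lemma dilation_preimage_itvcc c (s t : R) : 0 < c ->
  dil c @^-1` `[c * s, c * t] = `[s, t]%classic.
Proof.
by move=> c0; apply/seteqP; split=> x /=; rewrite !in_itv /= !ler_pM2l.
Qed.

Lemma lebesgue_measure_dilation c (A : set (measurableTypeR R)) : 0 < c ->
  measurable A -> (c%:E * mu (dil c @^-1` A))%E = mu A.
Proof.
move=> c0 mA.
suff key (nu : {measure set (measurableTypeR R) -> \bar R}) :
    nu = pushforward mu (dil c) :> (set _ -> _) -> (c%:E * nu A)%E = mu A.
  exact: (key (pushforward mu (dil c))).
move=> nuE; pose nuc := mscale (NngNum (ltW c0)) nu.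
rewrite -[LHS]/(nuc A).
apply/esym/lebesgue_measure_unique => //= _ [[a b]] _ <-.
rewrite /nuc /mscale nuE /pushforward /=.
rewrite (_ : dil c @^-1` _ = `](a / c), (b / c)]%classic); last first.
  apply/seteqP; split=> x /=; rewrite !in_itv /=.
    by rewrite ltr_pdivrMr // ler_pdivlMr // mulrC.
  by rewrite ltr_pdivrMr // ler_pdivlMr // [x * c]mulrC.
rewrite !lebesgue_measure_itv /= !lte_fin ltr_pM2r ?invr_gt0 //.
case: ifP => _; last by rewrite mule0.
by rewrite -!EFinD -EFinM -mulrBl mulrC divfK ?gt_eqF.
Qed.

Import HBNNSimple HBSimple.

Lemma sintegral_dilation c (h : {nnsfun (measurableTypeR R) >-> R}) : 0 < c ->
  exists2 g : {nnsfun (measurableTypeR R) >-> R}, (forall x, g x = h (c * x)) &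
    (c%:E * sintegral mu g)%E = sintegral mu h.
Proof.
move=> c0; pose f := h \o dil c.
have mf : measurable_fun [set: measurableTypeR R] f.
  apply: measurableT_comp; [exact: measurable_funPT | exact: measurable_dilation].
have ff : finite_set (range f).
  apply: (@sub_finite_set _ _ (range h)); last exact: fimfunP.
  by move=> _ [x _ <-]; exists (c * x).
have f0 x : 0 <= f x by [].
pose mf_ := isMeasurableFun.Build _ _ _ _ _ mf.
pose ff_ := FiniteImage.Build _ _ f ff.
pose f0_ := isNonNegFun.Build _ _ f f0.
pose g : {nnsfun (measurableTypeR R) >-> R} := HB.pack f mf_ ff_ f0_.
exists g => //.
rewrite !sintegralET ge0_mule_fsumr; last exact: nnsfun_mulemu_ge0.
apply: eq_fsbigr => x _; rewrite muleCA; congr (_ * _)%E.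
by rewrite -(lebesgue_measure_dilation c0 (measurable_funPTI h (measurable_set1 x))).
Qed.

(** Dilations permute the simple functions below [f], of which the integral is
    the supremum, so that the identity holds for an arbitrary [f]; it will be
    applied to squares involving the Volterra kernel. *)
Lemma ge0_integralT_dilation c (f : R -> \bar R) : 0 < c ->
  (forall x, 0 <= f x)%E ->
  (\int[mu]_x f x = c%:E * \int[mu]_x f (c * x)%R)%E.
Proof.
have le (b : R) (k : R -> \bar R) : 0 < b -> (forall x, 0 <= k x)%E ->
    (\int[mu]_x k x <= b%:E * \int[mu]_x k (b * x)%R)%E.
  move=> b0 k0; rewrite !ge0_integralTE //.
  apply: ge_ereal_sup => _ [h /= hk <-].
  have [g gE <-] := sintegral_dilation h b0.
  rewrite lee_pmul2l ?lte_fin //; apply: ereal_sup_ubound.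
  by exists g => //= x; rewrite gE.
move=> c0 f0; apply/le_anti; rewrite le //=.
rewrite -lee_pdivlMl //.
apply: (le_trans (le c^-1 (fun x => f (c * x)) _ _)) => //; first by rewrite invr_gt0.
under eq_integral do rewrite mulVKf ?gt_eqF //.
by [].
Qed.

Lemma integral_dilation c D (f : R -> \bar R) : 0 < c ->
  (\int[mu]_(x in D) f x = c%:E * \int[mu]_(x in dil c @^-1` D) f (c * x)%R)%E.
Proof.
move=> c0.
have ge0 (g : R -> \bar R) : (forall x, 0 <= g x)%E ->
    (\int[mu]_(x in D) g x = c%:E * \int[mu]_(x in dil c @^-1` D) g (c * x)%R)%E.
  move=> g0; rewrite integral_mkcond (ge0_integralT_dilation c0) /=; last first.
    by move=> x; rewrite /patch; case: ifP.
  rewrite [in RHS]integral_mkcond; congr (_ * _)%E.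
have posE : (fun x => f (c * x)%R)^\+%E = (fun x => f^\+%E (c * x)).
  by apply/funext => x; rewrite !funeposE.
have negE : (fun x => f (c * x)%R)^\-%E = (fun x => f^\-%E (c * x)).
  by apply/funext => x; rewrite !funenegE.
rewrite integralE [in RHS]integralE posE negE (ge0 _ (funepos_ge0 f)) (ge0 _ (funeneg_ge0 f)).
set a := integral _ _ _; set b := integral _ _ _.
case: a => [a| |]; case: b => [b| |] //=;
  rewrite -?EFinD -?EFinM ?mulrBr //; 
  rewrite ?gt0_muley ?gt0_muleNy ?lte_fin //=.
Qed.

Lemma integral_dilation_itvcc c (s t : R) (f : R -> \bar R) : 0 < c ->
  (\int[mu]_(x in `[(c * s)%R, (c * t)%R]) f x =
   c%:E * \int[mu]_(x in `[s, t]) f (c * x)%R)%E.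
Proof. by move=> c0; rewrite (integral_dilation _ _ c0) dilation_preimage_itvcc. Qed.

End dilation.

(** * Comparison for primitives of the drift *)

Section comparison.
Variable R : realType.
Local Notation mu := (@lebesgue_measure R).
Implicit Types (J g : R -> R) (s t u T k e gam sig : R).

(** [J] is absolutely continuous on [T, +oo[ with derivative [g]. *)
Definition primitive_from T J g := forall s t, T <= s -> s <= t ->
  mu.-integrable `[s, t] (EFin \o g) /\
  (J t - J s)%:E = (\int[mu]_(u in `[s, t]) (g u)%:E)%E.

Lemma primitive_fromN T J g : primitive_from T J g ->
  primitive_from T (fun t => - J t) (fun t => - g t).
Proof.
move=> JP s t Ts st; have [ig Jg] := JP s t Ts st; split.
  exact: (integrableN ig).
rewrite opprK addrC -opprB EFinN Jg -integralN //=.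
by apply: integrable_add_def.
Qed.

Lemma primitive_fromS T T' J g : T <= T' -> primitive_from T J g ->
  primitive_from T' J g.
Proof. by move=> TT' JP s t /(le_trans TT'); exact: JP. Qed.

Lemma is_derive_shifted_powR gam sig u : sig < u ->
  is_derive u 1 (fun v => (v - sig) `^ gam) (gam * (u - sig) `^ (gam - 1)).
Proof.
move=> su.
have du : is_derive (u - sig) 1 (@powR R ^~ gam) (gam * (u - sig) `^ (gam - 1)).
  by apply: is_derive1_powR; rewrite subr_gt0.
have di : is_derive u 1 (fun v => v - sig) 1.
  have := is_deriveB (is_derive_id u 1) (is_derive_cst sig u 1).
  by rewrite subr0.
have := @is_derive1_comp R (@powR R ^~ gam) (fun v => v - sig) u _ _ du di.
by rewrite mulr1.
Qed.

Lemma shifted_powR_continuous gam sig u : sig < u ->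
  {for u, continuous (fun v => (v - sig) `^ gam)}.
Proof.
move=> su; apply: differentiable_continuous; apply/derivable1_diffP.
exact: (@ex_derive _ _ _ _ _ _ _ (is_derive_shifted_powR gam su)).
Qed.

Lemma powR_continuous gam u : 0 < u -> {for u, continuous (fun v : R => v `^ gam)}.
Proof.
move=> u0; have := @shifted_powR_continuous gam 0 u u0.
have -> : (fun v : R => (v - 0) `^ gam) = (fun v : R => v `^ gam).
  by apply/funext => v; rewrite subr0.
by [].
Qed.

Lemma integral_shifted_powR gam sig s t : sig < s -> s < t ->
  mu.-integrable `[s, t] (fun u => (gam * (u - sig) `^ (gam - 1))%:E) /\
  (\int[mu]_(u in `[s, t]) (gam * (u - sig) `^ (gam - 1))%:E =
   ((t - sig) `^ gam - (s - sig) `^ gam)%:E)%E.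
Proof.
move=> sigs st.
have cf : {within `[s, t], continuous (fun u => gam * (u - sig) `^ (gam - 1))}.
  apply: continuous_in_subspaceT => u; rewrite inE /= in_itv /= => /andP[su _].
  apply: (@cvgM _ _ _ _ (fun=> gam)); first exact: cvg_cst.
  by apply: shifted_powR_continuous; rewrite (lt_le_trans sigs).
split.
  exact: continuous_compact_integrable (@segment_compact _ _ _) cf.
rewrite (@continuous_FTC2 _ _ (fun v => (v - sig) `^ gam) _ _ st cf) //.
- split.
  + move=> u; rewrite in_itv /= => /andP[su _].
    exact: (@ex_derive _ _ _ _ _ _ _ (is_derive_shifted_powR gam (lt_trans sigs su))).
  + by apply: cvg_at_right_filter; exact: shifted_powR_continuous.
  + by apply: cvg_at_left_filter; apply: shifted_powR_continuous; rewrite (lt_trans sigs).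
- move=> u; rewrite in_itv /= => /andP[su _]; rewrite derive1E.
  by apply: derive_val; apply: is_derive_shifted_powR; rewrite (lt_trans sigs).
Qed.

(** The comparison functions are the shifted powers because the extremal
    solutions of the equation without noise are. *)
Lemma primitive_lower T J g gam sig k s t : primitive_from T J g ->
  T <= s -> sig < s -> s <= t ->
  (forall u, s < u < t -> k * (gam * (u - sig) `^ (gam - 1)) <= g u) ->
  k * ((t - sig) `^ gam - (s - sig) `^ gam) <= J t - J s.
Proof.
move=> JP Ts sigs; rewrite le_eqVlt => /orP[/eqP<- _|st gP].
  by rewrite !subrr mulr0.
have [ig Jg] := JP s t Ts (ltW st).
have [ip pE] := integral_shifted_powR gam sigs st.
rewrite -lee_fin Jg EFinM -pE -integralZl //.
have mp : mu.-integrable `]s, t[ (fun u => k%:E * (gam * (u - sig) `^ (gam - 1))%:E)%E.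
  apply: integrableZl => //; apply: integrableS ip => //.
  exact: subset_itv_oo_cc.
have mg : mu.-integrable `]s, t[ (EFin \o g).
  apply: integrableS ig => //.
  by move=> u /=; rewrite !in_itv /= => /andP[? ?]; rewrite !ltW.
have itvE (f : R -> \bar R) : mu.-integrable `]s, t[ f ->
    (\int[mu]_(u in `[s, t]) f u = \int[mu]_(u in `]s, t[) f u)%E.
  by move=> /integrableP[mf _]; exact: integral_itv_bndoo.
rewrite (itvE _ mp) (itvE _ mg).
apply: le_integral => // u; rewrite inE /= in_itv /= => su.
by rewrite -EFinM lee_fin; exact: gP.
Qed.

Lemma primitive_upper T J g gam sig k s t : primitive_from T J g ->
  T <= s -> sig < s -> s <= t ->
  (forall u, s < u < t -> g u <= k * (gam * (u - sig) `^ (gam - 1))) ->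
  J t - J s <= k * ((t - sig) `^ gam - (s - sig) `^ gam).
Proof.
move=> /primitive_fromN JP Ts sigs st gP.
have H : - k * ((t - sig) `^ gam - (s - sig) `^ gam) <= - J t - - J s.
  by apply: (primitive_lower JP) => // u su; rewrite mulNr lerN2; exact: gP.
by rewrite -lerN2 -mulNr (le_trans H) // opprK opprB addrC.
Qed.

Lemma primitive_continuous T J g M : primitive_from T J g ->
  (forall u, T <= u -> `|g u| <= M) ->
  forall t, T < t -> {for t, continuous J}.
Proof.
move=> JP gM t Tt.
have M0 : 0 <= M by apply: le_trans (gM t (ltW Tt)).
have lip s u : T <= s -> s <= u -> `|J u - J s| <= M * (u - s).
  move=> Ts su.
  have e1 (v : R) : 1 * (v - (s - 1)) `^ (1 - 1) = 1 by rewrite subrr powRr0 mulr1.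
  have e2 : (u - (s - 1)) `^ 1 - (s - (s - 1)) `^ 1 = u - s.
    by rewrite !powRr1 ?subKr ?opprB; lra.
  have b1 : s - 1 < s by rewrite ltrBlDr ltrDl.
  rewrite ler_norml -e2 -mulNr; apply/andP; split.
    apply: (primitive_lower JP) => // v /andP[sv _]; rewrite e1 mulr1.
    by have := gM v (le_trans Ts (ltW sv)); rewrite ler_norml => /andP[].
  apply: (primitive_upper JP) => // v /andP[sv _]; rewrite e1 mulr1.
  by have := gM v (le_trans Ts (ltW sv)); rewrite ler_norml => /andP[].
apply/cvgrPdist_lt => e e0.
near=> u.
have Tu : T < u by near: u; exact: lt_nbhsr.
have ut : `|t - u| < e / (M + 1).
  near: u; apply: (@nbhsx_ballx _ _ t (e / (M + 1))).
  by rewrite divr_gt0 // ltr_wpDl.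
have M1 : 0 < M + 1 by rewrite ltr_wpDl.
rewrite ltr_pdivlMr // in ut.
apply: le_lt_trans ut.
have [tu|ut] := leP t u.
  rewrite distrC [`|t - u|]distrC (le_trans (lip _ _ (ltW Tt) tu)) //.
  by rewrite ger0_norm ?subr_ge0 // mulrC ler_wpM2l ?subr_ge0 // lerDl.
rewrite (le_trans (lip _ _ (ltW Tu) (ltW ut))) //.
by rewrite gtr0_norm ?subr_gt0 // mulrC ler_wpM2l ?subr_ge0 ?(ltW ut) // lerDl.
Unshelve. all: by end_near.
Qed.

End comparison.

Section barriers.
Variable R : realType.
Implicit Types (D : R -> R) (s t u v T : R).

(** At the infimum of the times where [D <= 0], [D] is positive by the
    hypothesis, hence positive shortly afterwards by right-continuity. *)
Lemma first_exit_pos D s0 :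
  (forall t, s0 <= t -> D s @[s --> t^'+] --> D t) ->
  (forall v, s0 <= v -> (forall s, s0 <= s < v -> 0 <= D s) -> 0 < D v) ->
  forall v, s0 <= v -> 0 < D v.
Proof.
move=> cD HD v s0v; rewrite ltNge; apply/negP => Dv.
pose A := [set t | s0 <= t /\ D t <= 0].
have iA : has_inf A by split; [exists v | exists s0 => t []].
pose m := inf A.
have s0m : s0 <= m by apply: lb_le_inf; [exists v|move=> t []].
have Dm : 0 < D m.
  apply: HD => // s /andP[s0s sm]; rewrite leNgt; apply/negP => Ds.
  by have := ge_inf iA.2 (conj s0s (ltW Ds)); rewrite leNgt sm.
have [r r0 rP] := cvg_at_right_ltP (cD m s0m) Dm.
have [a [s0a Da] am] := inf_adherent r0 iA.
have : m <= a by apply: (ge_inf iA.2).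
rewrite le_eqVlt => /orP[/eqP ma|ma]; first by move: Da; rewrite -ma leNgt Dm.
have := rP a; rewrite ma am => /(_ isT); rewrite ltr_norml => /andP[+ _].
by rewrite ltrBDl subrr ltNge Da.
Qed.

(** Were [D] negative at [t1], it would be so since the last time [m] before
    [t1] where it was nonnegative, against the hypothesis at [m]. *)
Lemma barrier_nonneg D T t0 :
  (forall t, T < t -> {for t, continuous D}) -> T < t0 -> 0 <= D t0 ->
  (forall s, T < s -> 0 <= D s -> exists2 r, s < r &
     forall t, s < t <= r -> (forall u, s < u <= t -> D u < 0) -> 0 <= D t) ->
  forall t, t0 <= t -> 0 <= D t.
Proof.
move=> cD Tt0 Dt0 HD t1 t01; rewrite leNgt; apply/negP => Dt1.
pose A := [set u | t0 <= u <= t1 /\ 0 <= D u].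
have At0 : A t0 by split; rewrite ?lexx.
have sA : has_sup A by split; [exists t0 | exists t1 => u [/andP[]]].
pose m := sup A.
have t0m : t0 <= m by apply: (ub_le_sup sA.2).
have mt1 : m <= t1 by apply: ge_sup; [exists t0 | move=> u [/andP[]]].
have Dm : 0 <= D m.
  rewrite leNgt; apply/negP => Dm.
  have /cvgrPdist_lt /(_ (- D m)) := cD m (lt_le_trans Tt0 t0m).
  rewrite oppr_gt0 => /(_ Dm) [r /= r0 rP].
  have [a [/andP[ta at1] Da] am] := sup_adherent r0 sA.
  have am' : a <= m by apply: (ub_le_sup sA.2); split=> //; rewrite ta.
  have ma : `|m - a| < r.
    by rewrite ger0_norm ?subr_ge0 // ltrBlDl -ltrBlDr.
  have := rP a ma; rewrite /= ltr_norml => /andP[+ _].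
  by rewrite opprK ltrBrDr gtrDl ltNge Da.
have mt : m < t1.
  by rewrite lt_neqAle mt1 andbT; apply/eqP => mt; move: Dm; rewrite mt leNgt Dt1.
have Dneg u : m < u <= t1 -> D u < 0.
  move=> /andP[mu ut1]; rewrite ltNge; apply/negP => Du.
  suff : u <= m by rewrite leNgt mu.
  by apply: (ub_le_sup sA.2); split=> //; rewrite ut1 (le_trans t0m) // ltW.
have [r mr rP] := HD m (lt_le_trans Tt0 t0m) Dm.
have : 0 <= D (Num.min r t1).
  apply: rP; first by rewrite lt_min mr mt ge_min lexx.
  move=> u /andP[mu]; rewrite le_min => /andP[_ ut1].
  by apply: Dneg; rewrite mu.
by rewrite leNgt Dneg // lt_min mr mt ge_min lexx orbT.
Qed.

End barriers.

Section power_scale.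
Variables (R : realType) (alpha : R).
Hypothesis alpha1 : alpha < 1.
Local Notation gam := ((1 - alpha)^-1).
Implicit Types (a c t u : R).

Let gam0 : 0 < gam. Proof. by rewrite invr_gt0 subr_gt0. Qed.
Let al0 : 1 - alpha != 0. Proof. by rewrite subr_eq0 gt_eqF. Qed.

Lemma gam_alpha : gam * alpha = gam - 1.
Proof. by apply: (mulfI al0); rewrite mulrBr mulrA divff // mul1r mulr1; lra. Qed.

(** The slope of [a * t ^ gam] in the scale of [t ^ gam]: along this curve the
    drift is the derivative of [drift_slope c a * t ^ gam]. *)
Definition drift_slope c a := (1 - alpha) * c * a `^ alpha.

(** The solution of [y' = c * y ^ alpha] which leaves 0 at once is
    [extremal_coef c * t ^ gam]; it is the fixed point of [drift_slope c]. *)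
Definition extremal_coef c := ((1 - alpha) * c) `^ gam.

Lemma extremal_coef_gt0 c : 0 < c -> 0 < extremal_coef c.
Proof. by move=> c0; rewrite powR_gt0 // mulr_gt0 // subr_gt0. Qed.

Lemma drift_slope_gt0 c a : 0 < c -> 0 < a -> 0 < drift_slope c a.
Proof. by move=> c0 a0; rewrite mulr_gt0 ?powR_gt0 // mulr_gt0 // subr_gt0. Qed.

Lemma powR_split a : 0 < a -> a = a `^ (1 - alpha) * a `^ alpha.
Proof.
move=> a0; rewrite -powRD; last by rewrite (gt_eqF a0) implybT.
by rewrite subrK powRr1 // ltW.
Qed.

Lemma extremal_coefK c : 0 < c -> extremal_coef c `^ (1 - alpha) = (1 - alpha) * c.
Proof.
move=> c0; rewrite /extremal_coef -powRrM mulVf // powRr1 //.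
by rewrite mulr_ge0 ?(ltW c0) // subr_ge0 ltW.
Qed.

Lemma drift_slope_gt c a : 0 < c -> 0 < a -> a < extremal_coef c -> a < drift_slope c a.
Proof.
move=> c0 a0 aA; rewrite {1}(powR_split a0) /drift_slope ltr_pM2r ?powR_gt0 //.
rewrite -extremal_coefK // gt0_ltr_powR ?subr_gt0 // ?nnegrE ?(ltW a0) //.
exact: powR_ge0.
Qed.

Lemma drift_slope_lt c a : 0 < c -> extremal_coef c < a -> drift_slope c a < a.
Proof.
move=> c0 aA; have a0 : 0 < a by exact: lt_trans (extremal_coef_gt0 c0) aA.
rewrite [ltRHS](powR_split a0) /drift_slope ltr_pM2r ?powR_gt0 //.
rewrite -extremal_coefK // gt0_ltr_powR ?subr_gt0 // ?nnegrE ?(ltW a0) //.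
exact: powR_ge0.
Qed.

Lemma drift_along_power c a t : 0 < a -> 0 < t ->
  c * (a * t `^ gam) `^ alpha = drift_slope c a * (gam * t `^ (gam - 1)).
Proof.
move=> a0 t0; rewrite powRM ?powR_ge0 ?(ltW a0) // -powRrM gam_alpha.
rewrite /drift_slope -!mulrA; rewrite [RHS]mulrCA; congr (_ * _).
rewrite [RHS]mulrCA; congr (_ * _).
by rewrite mulrA divff // mul1r.
Qed.

Lemma powR_unbounded (M : R) : exists2 t, 0 < t & M < t `^ gam.
Proof.
have M0 : 0 < `|M| + 1 by rewrite ltr_wpDl.
exists ((`|M| + 1) `^ (1 - alpha)); first exact: powR_gt0.
rewrite -powRrM divff // powRr1 ?(ltW M0) //.
by rewrite (le_lt_trans (ler_norm M)) // ltrDl.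
Qed.

Lemma le_powR_gam t u : 0 <= t -> t <= u -> t `^ gam <= u `^ gam.
Proof.
move=> t0 tu; apply: ge0_ler_powR => //; rewrite ?nnegrE ?(ltW gam0) //.
exact: le_trans tu.
Qed.

Lemma powR_shift a a1 (tau : R) : 0 < a -> a < a1 ->
  exists T, forall t, T <= t -> 0 < t - tau /\ a * t `^ gam <= a1 * (t - tau) `^ gam.
Proof.
move=> a0 aa1; have a10 : 0 < a1 by exact: lt_trans aa1.
pose r := (a / a1) `^ (1 - alpha).
have rgam : r `^ gam = a / a1.
  by rewrite /r -powRrM divff // powRr1 // divr_ge0 ?ltW.
have r0 : 0 < r by rewrite powR_gt0 // divr_gt0.
have r1 : r < 1.
  have e : 1 `^ (1 - alpha) = 1 :> R by rewrite powR1.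
  rewrite -[ltRHS]e gt0_ltr_powR ?subr_gt0 // ?nnegrE ?divr_ge0 ?ltW //.
  by rewrite ltr_pdivrMr // mul1r.
exists (`|tau / (1 - r)| + `|tau| + 1) => t tT.
have n1 : tau / (1 - r) <= `|tau / (1 - r)| := ler_norm _.
have n2 : tau <= `|tau| := ler_norm _.
have n3 : 0 <= `|tau / (1 - r)| by [].
have n4 : 0 <= `|tau| by [].
have tt : tau / (1 - r) <= t by lra.
have t0 : 0 < t by lra.
have tau0 : 0 < t - tau by lra.
split => //.
have rt : r * t <= t - tau.
  move: tt; rewrite ler_pdivrMr ?subr_gt0 //; lra.
have -> : a * t `^ gam = a1 * (r * t) `^ gam.
  by rewrite powRM ?(ltW r0) ?(ltW t0) // rgam mulrA [a1 * _]mulrC divfK ?gt_eqF.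
rewrite ler_pM2l //; apply: le_powR_gam => //.
by rewrite mulr_ge0 ?ltW.
Qed.

End power_scale.

(** * Long-time behaviour of the paths *)

Section asymptotics.
Variables (R : realType) (alpha : R).
Hypothesis alpha1 : alpha < 1.
Local Notation gam := ((1 - alpha)^-1).
Implicit Types (x J g b : R -> R) (cp cm c a t u T s eta C : R).

(** A path of the equation from time [T] on, when it stays away from the
    singularity of the drift: [J] is the integral of the drift [g]. *)
Definition sde_path T cp cm x J g b := [/\ primitive_from T J g,
  forall u, T <= u -> x u = J u + b u,
  forall u, T <= u -> x s @[s --> u^'+] --> x u,
  forall u, T <= u -> 1 <= `|x u| &
  forall u, T <= u ->
    g u = if 0 < x u then cp * x u `^ alpha else - (cm * `|x u| `^ alpha)].

Lemma sde_pathN T cp cm x J g b : sde_path T cp cm x J g b ->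
  sde_path T cm cp (fun t => - x t) (fun t => - J t) (fun t => - g t) (fun t => - b t).
Proof.
move=> [JP xJ xr x1 gE]; split.
- exact: primitive_fromN.
- by move=> u Tu; rewrite xJ // opprD.
- by move=> u Tu; apply: cvgN; exact: xr.
- by move=> u Tu; rewrite normrN x1.
- move=> u Tu; rewrite gE // normrN oppr_gt0.
  have := x1 u Tu; case: (ltrgtP (x u) 0) => xu0 xu1.
  + by rewrite ltr0_norm // opprK.
  + by rewrite gtr0_norm.
  + by move: xu1; rewrite xu0 normr0 ler10.
Qed.

Lemma sde_pathS T T' cp cm x J g b : T <= T' -> sde_path T cp cm x J g b ->
  sde_path T' cp cm x J g b.
Proof.
move=> TT' [JP xJ xr x1 gE]; split.
- exact: primitive_fromS JP.
- by move=> u /(le_trans TT'); exact: xJ.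
- by move=> u /(le_trans TT'); exact: xr.
- by move=> u /(le_trans TT'); exact: x1.
- by move=> u /(le_trans TT'); exact: gE.
Qed.

(** [x t / t ^ gam] tends to [l]. *)
Definition asymptotic_to x (l : R) := forall d, 0 < d ->
  exists T, forall t, T <= t -> `|x t - l * t `^ gam| <= d * t `^ gam.

(** The noise admits arbitrarily late restarting times, at which the path is
    arbitrarily far from 0 and after which the noise is negligible. *)
Definition restarts x b := forall eta, 0 < eta -> exists C, forall K, exists s,
  [/\ K <= s, K <= `|x s| &
      forall t, s <= t -> `|b t - b s| <= C + eta * (t - s) `^ gam].

Lemma restartsN x b : restarts x b -> restarts (fun t => - x t) (fun t => - b t).
Proof.
move=> xb eta /xb[C CP]; exists C => K; have [s [Ks Kx bs]] := CP K.
exists s; split=> //; first by rewrite normrN.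
by move=> t /bs; rewrite -opprD normrN.
Qed.

Let gam0 : 0 < gam. Proof. by rewrite invr_gt0 subr_gt0. Qed.

Lemma power_cvg_right a sig t : sig < t ->
  a * (s - sig) `^ gam @[s --> t^'+] --> a * (t - sig) `^ gam.
Proof.
move=> st; apply: cvgMr.
by apply: cvg_at_right_filter; exact: shifted_powR_continuous.
Qed.

Lemma sub_power_cvg_right x a sig t : sig < t -> x s @[s --> t^'+] --> x t ->
  (x s - a * (s - sig) `^ gam) @[s --> t^'+] --> x t - a * (t - sig) `^ gam.
Proof.
by move=> st xt; apply: cvgB => //; exact: power_cvg_right.
Qed.

(** As long as the path is above [a * (t - (s - 1)) ^ gam], the drift, which is
    nondecreasing in the position, makes it grow at least like
    [drift_slope cp a * (t - (s - 1)) ^ gam], which beats the noise and the curve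
    as [eta + a <= drift_slope cp a]. *)
Lemma growth_lower T cp cm x J g b a eta C s : sde_path T cp cm x J g b ->
  0 <= alpha -> 0 < cp -> 0 < a -> 0 <= eta -> eta + a <= drift_slope alpha cp a ->
  T <= s -> (forall t, s <= t -> `|b t - b s| <= C + eta * (t - s) `^ gam) ->
  drift_slope alpha cp a + C < x s ->
  forall t, s <= t -> a * (t - (s - 1)) `^ gam < x t.
Proof.
move=> [JP xJ xr _ gE] al0 cp0 a0 eta0 ea Ts bs xs t st.
(* The curve starts at [s - 1] so as to take the value [a] at [s]. *)
have ss : s - 1 < s by rewrite ltrBlDr ltrDl.
rewrite -subr_gt0; move: t st; apply: first_exit_pos.
  move=> t st; apply: sub_power_cvg_right; first exact: lt_le_trans st.
  by apply: xr; exact: le_trans st.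
move=> v sv Dv.
have JJ : drift_slope alpha cp a * ((v - (s - 1)) `^ gam - (s - (s - 1)) `^ gam)
    <= J v - J s.
  apply: (primitive_lower JP) => // u /andP[su uv].
  have u1 : 0 < u - (s - 1) by rewrite subr_gt0 (lt_trans ss).
  have au : a * (u - (s - 1)) `^ gam <= x u.
    by rewrite -subr_ge0; apply: Dv; rewrite (ltW su).
  have xu : 0 < x u by apply: lt_le_trans au; rewrite mulr_gt0 ?powR_gt0.
  rewrite (gE u (le_trans Ts (ltW su))) xu -drift_along_power // ler_pM2l //.
  apply: ge0_ler_powR; rewrite ?nnegrE ?(ltW xu) //.
  by rewrite mulr_ge0 ?powR_ge0 // ltW.
have e1 : (s - (s - 1)) `^ gam = 1 by rewrite subKr powR1.
rewrite e1 in JJ.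
have := bs v sv; rewrite ler_norml => /andP[bv _].
have pv : (v - s) `^ gam <= (v - (s - 1)) `^ gam.
  by apply: le_powR_gam => //; [rewrite subr_ge0 | lra].
have pv1 : 0 <= (v - (s - 1)) `^ gam by exact: powR_ge0.
have Tv := le_trans Ts sv.
rewrite (xJ v Tv); move: xs; rewrite (xJ s Ts).
have epv := ler_wpM2l eta0 pv.
have eap := ler_wpM2r pv1 ea.
move: bv JJ epv eap; rewrite mulrDl mulrBr mulr1.
move: (_ `^ _) (_ `^ _) pv pv1 => p q _ _; move: (drift_slope _ _ _) => k.
lra.
Qed.

(** Symmetric to [growth_lower]: the curve is started early enough, [tau] before
    [s], to be above the path at time [s]. *)
Lemma growth_upper T cp cm x J g b a eta C s : sde_path T cp cm x J g b ->
  0 <= alpha -> 0 < cp -> 0 < a -> 0 <= eta -> eta + drift_slope alpha cp a <= a ->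
  T <= s -> (forall t, s <= t -> 0 < x t) ->
  (forall t, s <= t -> `|b t - b s| <= C + eta * (t - s) `^ gam) ->
  exists tau, forall t, s <= t -> x t < a * (t - (s - tau)) `^ gam.
Proof.
move=> [JP xJ xr _ gE] al0 cp0 a0 eta0 ea Ts x0 bs.
set k := drift_slope alpha cp a in ea *.
have k0 : 0 < k by exact: drift_slope_gt0.
have [tau tau0 tauP] := powR_unbounded alpha1 ((x s + C) / k).
exists tau => t st.
have ss : s - tau < s by rewrite ltrBlDr ltrDl.
rewrite -subr_gt0; move: t st; apply: first_exit_pos.
  move=> t st; apply: cvgB; last by apply: xr; exact: le_trans st.
  by apply: power_cvg_right; exact: lt_le_trans st.
move=> v sv Dv.
have JJ : J v - J s <= k * ((v - (s - tau)) `^ gam - (s - (s - tau)) `^ gam).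
  apply: (primitive_upper JP) => // u /andP[su uv].
  have u1 : 0 < u - (s - tau) by rewrite subr_gt0 (lt_trans ss).
  have au : x u <= a * (u - (s - tau)) `^ gam.
    by rewrite -subr_ge0; apply: Dv; rewrite (ltW su).
  have xu : 0 < x u by apply: x0; rewrite ltW.
  rewrite (gE u (le_trans Ts (ltW su))) xu -drift_along_power // ler_pM2l //.
  apply: ge0_ler_powR; rewrite ?nnegrE ?(ltW xu) //.
  by rewrite mulr_ge0 ?powR_ge0 // ltW.
have e1 : (s - (s - tau)) `^ gam = tau `^ gam by rewrite subKr.
rewrite e1 in JJ.
have := bs v sv; rewrite ler_norml => /andP[_ bv].
have pv : (v - s) `^ gam <= (v - (s - tau)) `^ gam.
  by apply: le_powR_gam => //; [rewrite subr_ge0 | lra].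
have pv1 : 0 <= (v - (s - tau)) `^ gam by exact: powR_ge0.
have Tv := le_trans Ts sv.
move: tauP; rewrite ltr_pdivrMr // (xJ v Tv) (xJ s Ts) => tauP.
have epv := ler_wpM2l eta0 pv.
have eap := ler_wpM2r pv1 ea.
move: bv JJ tauP epv eap; rewrite mulrDl mulrBr [_ * k]mulrC.
move: (_ `^ _) (_ `^ _) pv pv1 => p q _ _; move: (tau `^ _) => r.
clearbody k; lra.
Qed.

(** A restarting time at which the path is far enough from 0 decides its sign
    for ever. *)
Lemma growth_dichotomy T cp cm x J g b : sde_path T cp cm x J g b ->
  0 <= alpha -> 0 < cp -> 0 < cm -> restarts x b ->
  exists2 T', T <= T' &
    (forall t, T' <= t -> 0 < x t) \/ (forall t, T' <= t -> x t < 0).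
Proof.
move=> xP al0 cp0 cm0 xb.
pose a := Num.min (extremal_coef alpha cp) (extremal_coef alpha cm) / 2.
have Ap := extremal_coef_gt0 alpha1 cp0.
have Am := extremal_coef_gt0 alpha1 cm0.
have m0 : 0 < Num.min (extremal_coef alpha cp) (extremal_coef alpha cm).
  by rewrite lt_min Ap.
have a0 : 0 < a by rewrite divr_gt0.
have am : a < Num.min (extremal_coef alpha cp) (extremal_coef alpha cm).
  by rewrite ltr_pdivrMr // ltr_pMr // ltr1n.
move: am; rewrite lt_min => /andP[/(drift_slope_gt alpha1 cp0 a0) ap
  /(drift_slope_gt alpha1 cm0 a0) am].
have [kp kpE] : exists k, k = drift_slope alpha cp a by eexists.
have [km kmE] : exists k, k = drift_slope alpha cm a by eexists.
rewrite -kpE in ap; rewrite -kmE in am.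
pose eta := Num.min (kp - a) (km - a).
have eta0 : 0 < eta by rewrite lt_min !subr_gt0 ap.
have [C CP] := xb eta eta0.
have [s [Ks Kx bs]] := CP (`|T| + `|kp + C| + `|km + C| + 1).
have n1 := ler_norm T; have n2 := ler_norm (kp + C); have n3 := ler_norm (km + C).
have p1 : 0 <= `|T| by []. have p2 : 0 <= `|kp + C| by [].
have p3 : 0 <= `|km + C| by [].
have Ts : T <= s by lra.
have pow t : s <= t -> 0 < (t - (s - 1)) `^ gam.
  by move=> st; rewrite powR_gt0 //; lra.
exists s => //; case: (lerP 0 (x s)) => xs.
  left => t st; rewrite (ger0_norm xs) in Kx.
  apply: lt_trans (growth_lower xP al0 cp0 a0 (ltW eta0) _ Ts bs _ st).
  - by rewrite mulr_gt0 // pow.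
  - by rewrite -kpE -lerBrDr ge_min lexx.
  - by rewrite -kpE; lra.
right => t st; rewrite (ltr0_norm xs) in Kx.
rewrite -oppr_gt0.
have bs' u : s <= u -> `|- b u - - b s| <= C + eta * (u - s) `^ gam.
  by move=> /bs; rewrite -opprD normrN.
apply: lt_trans (growth_lower (sde_pathN xP) al0 cm0 a0 (ltW eta0) _ Ts bs' _ st).
- by rewrite mulr_gt0 // pow.
- by rewrite -kmE -lerBrDr ge_min lexx orbT.
- by rewrite -kmE; lra.
Qed.

Lemma asymptotic_to_squeeze x (A : R) : 0 < A ->
  (forall a, 0 < a < A -> exists T, forall t, T <= t -> a * t `^ gam <= x t) ->
  (forall a, A < a -> exists T, forall t, T <= t -> x t <= a * t `^ gam) ->
  asymptotic_to x A.
Proof.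
move=> A0 lo up d d0.
have [T1 lo1] : exists T, forall t, T <= t -> (A - d) * t `^ gam <= x t.
  pose a := Num.max (A - d) (A / 2).
  have [T TP] : exists T, forall t, T <= t -> a * t `^ gam <= x t.
    apply: lo; rewrite lt_max divr_gt0 ?orbT //= gt_max ltrBlDr ltrDl d0 /=.
    by rewrite ltr_pdivrMr // ltr_pMr // ltr1n.
  exists T => t /TP; apply: le_trans; apply: ler_wpM2r; first exact: powR_ge0.
  by rewrite le_max lexx.
have [|T2 up2] := up (A + d); first by rewrite ltrDl.
exists (Num.max T1 T2) => t; rewrite ge_max => /andP[/lo1 l1 /up2 u2].
rewrite ler_norml; move: l1 u2; rewrite mulrBl mulrDl.
by move: (_ `^ _) => p ? ?; apply/andP; split; lra.
Qed.

(** Both bounds restart the path: far from 0 for the lower one, anywhere for the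
    upper one. The shift of the curves is absorbed by [powR_shift]. *)
Lemma asymptotic_superlinear T cp cm x J g b : sde_path T cp cm x J g b ->
  0 <= alpha -> 0 < cp -> restarts x b -> (forall t, T <= t -> 0 < x t) ->
  asymptotic_to x (extremal_coef alpha cp).
Proof.
move=> xP al0 cp0 xb x0; apply: asymptotic_to_squeeze.
- exact: extremal_coef_gt0.
- move=> a /andP[a0 aA].
  pose a1 := (a + extremal_coef alpha cp) / 2.
  have aa1 : a < a1 by rewrite /a1; lra.
  have a1A : a1 < extremal_coef alpha cp by rewrite /a1; lra.
  have a10 : 0 < a1 by exact: lt_trans aa1.
  have [k kE] : exists k, k = drift_slope alpha cp a1 by eexists.
  have a1k := drift_slope_gt alpha1 cp0 a10 a1A; rewrite -kE in a1k.
  have [|C CP] := xb (k - a1); first by rewrite subr_gt0.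
  have [s [Ks Kx bs]] := CP (`|T| + `|k + C| + 1).
  have n1 := ler_norm T; have n2 := ler_norm (k + C).
  have p1 : 0 <= `|T| by []. have p2 : 0 <= `|k + C| by [].
  have Ts : T <= s by lra.
  rewrite (gtr0_norm (x0 s Ts)) in Kx.
  have [T' T'P] := powR_shift alpha1 (s - 1) a0 aa1.
  exists (Num.max T' s) => t; rewrite ge_max => /andP[/T'P[_ at1] st].
  apply: (le_trans at1); apply/ltW.
  apply: (growth_lower xP al0 cp0 a10 _ _ Ts bs _ st).
  + by rewrite subr_ge0 ltW.
  + by rewrite -kE subrK.
  + by rewrite -kE; lra.
- move=> a Aa; pose a1 := (a + extremal_coef alpha cp) / 2.
  have aa1 : a1 < a by rewrite /a1; lra.
  have a1A : extremal_coef alpha cp < a1 by rewrite /a1; lra.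
  have a10 : 0 < a1 by exact: lt_trans (extremal_coef_gt0 alpha1 cp0) a1A.
  have [k kE] : exists k, k = drift_slope alpha cp a1 by eexists.
  have a1k := drift_slope_lt alpha1 cp0 a1A; rewrite -kE in a1k.
  have [|C CP] := xb (a1 - k); first by rewrite subr_gt0.
  have [s [Ts _ bs]] := CP T.
  have x0' t : s <= t -> 0 < x t by move=> /(le_trans Ts); exact: x0.
  have [||tau tauP] := growth_upper xP al0 cp0 a10 _ _ Ts x0' bs.
  + by rewrite subr_ge0 ltW.
  + by rewrite -kE subrK.
  have [T' T'P] := powR_shift alpha1 (tau - s) a10 aa1.
  exists (Num.max (T' + (s - tau)) s) => t; rewrite ge_max => /andP[t1 st].
  apply: (le_trans (ltW (tauP t st))).
  have [|_] := T'P (t - (s - tau)); first by rewrite lerBrDr.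
  by rewrite (_ : t - (s - tau) - (tau - s) = t) //; ring.
Qed.

Definition negligible_noise b := forall eta, 0 < eta ->
  exists T, forall t, T <= t -> `|b t| <= eta * t `^ gam.

Lemma negligible_noiseN b : negligible_noise b -> negligible_noise (fun t => - b t).
Proof.
by move=> bn e /bn[T TP]; exists T => t /TP; rewrite normrN.
Qed.

Lemma drift_bounded T cp cm x J g b : sde_path T cp cm x J g b ->
  alpha <= 0 -> 0 < cp -> 0 < cm ->
  forall u, T <= u -> `|g u| <= cp + cm.
Proof.
move=> [_ _ _ x1 gE] al0 cp0 cm0 u Tu.
have p1 : `|x u| `^ alpha <= 1.
  rewrite -(powRr0 `|x u|); apply: ler_powR => //; exact: x1.
have p0 : 0 <= `|x u| `^ alpha by exact: powR_ge0.
have bound c : 0 < c -> `|c * `|x u| `^ alpha| <= c.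
  by move=> c0; rewrite ger0_norm ?ler_piMr ?mulr_ge0 // ltW.
rewrite gE //; case: ifPn => xu.
  by have := bound cp cp0; rewrite (gtr0_norm xu); lra.
by rewrite normrN; have := bound cm cm0; lra.
Qed.

(** While [D] is negative it gains at least what [k * t ^ gam] does, so that it
    reaches 0; [barrier_nonneg] then keeps it nonnegative. *)
Lemma eventually_nonneg (D : R -> R) T0 k : 0 < T0 -> 0 < k ->
  (forall t, T0 < t -> {for t, continuous D}) ->
  (forall s t, T0 < s -> s < t -> (forall u, s < u <= t -> D u < 0) ->
     k * (t `^ gam - s `^ gam) <= D t - D s) ->
  exists T, forall t, T <= t -> 0 <= D t.
Proof.
move=> T00 k0 cD HD.
have [t0 Tt0 Dt0] : exists2 t0, T0 < t0 & 0 <= D t0.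
  apply: contrapT => noD.
  have Dneg t : T0 < t -> D t < 0.
    by move=> Tt; rewrite ltNge; apply/negP => Dt; apply: noD; exists t.
  pose s := T0 + 1; have Ts : T0 < s by rewrite ltrDl.
  have [r r0 rP] := powR_unbounded alpha1 (s `^ gam - D s / k).
  pose t := Num.max (s + 1) r.
  have st : s < t by rewrite lt_max ltrDl ltr01.
  have rt : r `^ gam <= t `^ gam.
    by apply: le_powR_gam => //; [exact: ltW | rewrite le_max lexx orbT].
  have : k * (t `^ gam - s `^ gam) <= D t - D s.
    by apply: HD => // u /andP[su _]; apply: Dneg; exact: lt_trans su.
  have Dt : D t < 0 by apply: Dneg; exact: lt_trans st.
  rewrite leNgt => /negP; apply.
  have : - (D s / k) < t `^ gam - s `^ gam by lra.
  rewrite -(ltr_pM2l k0) mulrN mulrC divfK ?gt_eqF //.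
  by lra.
exists t0; apply: (barrier_nonneg cD Tt0 Dt0) => s Ts Ds.
exists (s + 1); first by rewrite ltrDl.
move=> t /andP[st _] Dneg; apply: le_trans Ds _.
rewrite -subr_ge0 (le_trans _ (HD _ _ Ts st Dneg)) //.
rewrite mulr_ge0 ?(ltW k0) // subr_ge0 le_powR_gam ?(ltW st) //.
by rewrite (le_trans (ltW T00)) // ltW.
Qed.

Lemma sub_power_continuous J a t : 0 < t -> {for t, continuous J} ->
  {for t, continuous (fun u => J u - a * u `^ gam)}.
Proof.
by move=> t0 cJ; apply: cvgB => //; apply: cvgMr; exact: powR_continuous.
Qed.

Lemma powR_antitone u v : 0 < u -> u <= v -> alpha <= 0 -> v `^ alpha <= u `^ alpha.
Proof.
move=> u0 uv al0; have v0 : 0 < v by exact: lt_le_trans uv.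
rewrite -[alpha]opprK !(powRN _ (- alpha)) lef_pV2 ?posrE ?powR_gt0 //.
by apply: ge0_ler_powR; rewrite ?nnegrE ?oppr_ge0 ?(ltW u0) ?(ltW v0).
Qed.

(** Here the drift is nonincreasing in the position: it pushes the path up below
    the extremal curve and down above it. As [x] may jump, the barrier argument
    is applied to the continuous part [J] of the path. *)
Lemma asymptotic_sublinear T cp cm x J g b : sde_path T cp cm x J g b ->
  alpha <= 0 -> 0 < cp -> 0 < cm -> negligible_noise b ->
  (forall t, T <= t -> 0 < x t) ->
  asymptotic_to x (extremal_coef alpha cp).
Proof.
move=> xP al0 cp0 cm0 bn x0.
have A0 := extremal_coef_gt0 alpha1 cp0.
have gM := drift_bounded xP al0 cp0 cm0.
have [JP xJ _ _ gE] := xP.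
have cJ := primitive_continuous JP gM.
have T1ex eta : 0 < eta -> exists T0, [/\ 0 < T0, T <= T0 &
    forall t, T0 <= t -> `|b t| <= eta * t `^ gam].
  move=> /bn[T' T'P]; exists (Num.max 1 (Num.max T T')); split.
  - by rewrite lt_max ltr01.
  - by rewrite !le_max lexx orbT.
  - by move=> t; rewrite !ge_max => /andP[_ /andP[_ ]]; exact: T'P.
apply: asymptotic_to_squeeze => //.
- move=> a /andP[a0 aA].
  pose eta := (extremal_coef alpha cp - a) / 3.
  have eta0 : 0 < eta by rewrite divr_gt0 // subr_gt0.
  pose a1 := a + eta; pose a2 := a1 + eta.
  have a10 : 0 < a1 by rewrite addr_gt0.
  have a20 : 0 < a2 by rewrite addr_gt0.
  have a2A : a2 < extremal_coef alpha cp by rewrite /a2 /a1 /eta; lra.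
  have a2k := drift_slope_gt alpha1 cp0 a20 a2A.
  have [T0 [T00 TT0 bT0]] := T1ex eta eta0.
  have [|||T' T'P] := @eventually_nonneg (fun t => J t - a1 * t `^ gam) T0
     (drift_slope alpha cp a2 - a1) T00.
  + by rewrite subr_gt0 (lt_trans _ a2k) // ltrDl.
  + move=> t Tt; apply: sub_power_continuous; first exact: lt_trans Tt.
    by apply: cJ; exact: le_lt_trans Tt.
  + move=> s t Ts st Dneg.
    have s0 : 0 < s by exact: lt_trans Ts.
    suff : drift_slope alpha cp a2 * ((t - 0) `^ gam - (s - 0) `^ gam) <= J t - J s.
      by rewrite !subr0; move: (_ `^ _) (_ `^ _) (drift_slope _ _ _) => p q k; lra.
    apply: (primitive_lower JP) => //; [|exact: ltW|].
      by rewrite (le_trans TT0) // ltW.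
    move=> u /andP[su ut]; have u0 : 0 < u by exact: lt_trans su.
    have Tu : T0 <= u by rewrite ltW // (lt_trans Ts).
    have TTu := le_trans TT0 Tu.
    rewrite gE // x0 // subr0 -drift_along_power // ler_pM2l //.
    apply: powR_antitone => //; first exact: x0.
    rewrite xJ //; have := Dneg u; rewrite su (ltW ut) => /(_ isT).
    have := bT0 u Tu; rewrite ler_norml => /andP[_].
    by rewrite /a2; move: (_ `^ _) => p; lra.
  exists (Num.max T' T0) => t; rewrite ge_max => /andP[/T'P Dt Tt].
  rewrite xJ ?(le_trans TT0) //.
  have := bT0 t Tt; rewrite ler_norml => /andP[+ _].
  by move: Dt; rewrite /a1; move: (_ `^ _) => p; lra.
- move=> a Aa.
  pose eta := (a - extremal_coef alpha cp) / 3.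
  have eta0 : 0 < eta by rewrite divr_gt0 // subr_gt0.
  pose a1 := a - eta; pose a2 := a1 - eta.
  have a2A : extremal_coef alpha cp < a2 by rewrite /a2 /a1 /eta; lra.
  have a20 : 0 < a2 by exact: lt_trans a2A.
  have a2k := drift_slope_lt alpha1 cp0 a2A.
  have [T0 [T00 TT0 bT0]] := T1ex eta eta0.
  have [|||T' T'P] := @eventually_nonneg (fun t => - (J t - a1 * t `^ gam)) T0
     (a1 - drift_slope alpha cp a2) T00.
  + by rewrite subr_gt0 (lt_trans a2k) // /a2; lra.
  + move=> t Tt; apply: cvgN; apply: sub_power_continuous; first exact: lt_trans Tt.
    by apply: cJ; exact: le_lt_trans Tt.
  + move=> s t Ts st Dneg.
    have s0 : 0 < s by exact: lt_trans Ts.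
    suff : J t - J s <= drift_slope alpha cp a2 * ((t - 0) `^ gam - (s - 0) `^ gam).
      by rewrite !subr0; move: (_ `^ _) (_ `^ _) (drift_slope _ _ _) => p q k; lra.
    apply: (primitive_upper JP) => //; [|exact: ltW|].
      by rewrite (le_trans TT0) // ltW.
    move=> u /andP[su ut]; have u0 : 0 < u by exact: lt_trans su.
    have Tu : T0 <= u by rewrite ltW // (lt_trans Ts).
    have TTu := le_trans TT0 Tu.
    rewrite gE // x0 // subr0 -drift_along_power // ler_pM2l //.
    apply: powR_antitone => //; first by rewrite mulr_gt0 ?powR_gt0.
    rewrite xJ //; have := Dneg u; rewrite su (ltW ut) => /(_ isT).
    have := bT0 u Tu; rewrite ler_norml => /andP[+ _].
    by rewrite /a2; move: (_ `^ _) => p; lra.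
  exists (Num.max T' T0) => t; rewrite ge_max => /andP[/T'P Dt Tt].
  rewrite xJ ?(le_trans TT0) //.
  have := bT0 t Tt; rewrite ler_norml => /andP[_ +].
  by move: Dt; rewrite /a1; move: (_ `^ _) => p; lra.
Qed.

End asymptotics.

Section long_time.
Variables (R : realType) (alpha : R).
Hypothesis alpha1 : alpha < 1.
Local Notation gam := ((1 - alpha)^-1).
Local Notation mu := (@lebesgue_measure R).
Implicit Types (x J g b h : R -> R) (cp cm c a t u T s eta C : R).

Let gam0 : 0 < gam. Proof. by rewrite invr_gt0 subr_gt0. Qed.

(** When the noise is negligible, the integral of the drift cannot reach
    [eta * t ^ gam] without staying above it, because slightly below this curve
    the path is positive and the drift is steeper than the curve. *)
Lemma oscillation_upper T cp cm x J g b : sde_path alpha T cp cm x J g b ->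
  alpha <= 0 -> 0 < cp -> 0 < cm -> negligible_noise alpha b ->
  ~ (exists T', forall t, T' <= t -> 0 < x t) ->
  forall d, 0 < d -> exists T', forall t, T' <= t -> x t <= d * t `^ gam.
Proof.
move=> xP al0 cp0 cm0 bn xosc d d0.
have A0 := extremal_coef_gt0 alpha1 cp0.
have [JP xJ _ _ gE] := xP.
have cJ := primitive_continuous JP (drift_bounded xP al0 cp0 cm0).
pose eta := Num.min d (extremal_coef alpha cp) / 4.
have m0 : 0 < Num.min d (extremal_coef alpha cp) by rewrite lt_min d0.
have eta0 : 0 < eta by rewrite divr_gt0.
have eta_d : eta * 4 <= d by rewrite /eta divfK // ge_min lexx.
have eta_A : eta * 4 <= extremal_coef alpha cp by rewrite /eta divfK // ge_min lexx orbT.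
clearbody eta.
have [|T0' T0'P] := bn (eta / 4); first by rewrite divr_gt0.
pose T0 := Num.max 1 (Num.max T T0').
have T00 : 0 < T0 by rewrite lt_max ltr01.
have TT0 : T <= T0 by rewrite !le_max lexx orbT.
have bT0 t : T0 <= t -> `|b t| <= eta / 4 * t `^ gam.
  by rewrite /T0 !ge_max => /andP[_ /andP[_]]; exact: T0'P.
clearbody T0.
(* As long as [J] is between [3/4] and [1] times [eta * t ^ gam], the path, which
   the noise moves by [1/4] of it, is between [1/2] and [5/4] times it. *)
pose a1 := eta * (3 / 4); pose a2 := eta * (5 / 4).
have a20 : 0 < a2 by rewrite mulr_gt0.
have a2A : a2 < extremal_coef alpha cp by rewrite /a2; lra.
have a2k := drift_slope_gt alpha1 cp0 a20 a2A.
have eta_k : eta < drift_slope alpha cp a2 by apply: lt_trans a2k; rewrite /a2; lra.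
pose D a t := J t - a * t `^ gam.
have cD a t : T0 < t -> {for t, continuous (D a)}.
  move=> Tt; apply: sub_power_continuous; first exact: lt_trans Tt.
  by apply: cJ; exact: le_lt_trans Tt.
have HD s : T0 < s -> 0 <= D eta s -> exists2 r, s < r &
    forall t, s < t <= r -> (forall u, s < u <= t -> D eta u < 0) -> 0 <= D eta t.
  move=> Ts Ds; have s0 : 0 < s by exact: lt_trans Ts.
  have D1s : 0 < D a1 s.
    have : 0 < s `^ gam by rewrite powR_gt0.
    move: Ds; rewrite /D /a1; move: (s `^ gam) => p Ds p0.
    have := mulr_gt0 eta0 p0; lra.
  have /cvg_at_right_filter D1c : D a1 u @[u --> s] --> D a1 s by exact: cD.
  have [r r0 rP] := cvg_at_right_ltP D1c D1s.
  exists (s + r / 2); first by rewrite ltrDl divr_gt0.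
  move=> t /andP[st tr] Dneg; apply: le_trans Ds _.
  have pst : s `^ gam <= t `^ gam by apply: le_powR_gam => //; exact: ltW.
  have : drift_slope alpha cp a2 * ((t - 0) `^ gam - (s - 0) `^ gam) <= J t - J s.
    apply: (primitive_lower JP) => //; [|exact: ltW|].
      by rewrite (le_trans TT0) // ltW.
    move=> u /andP[su ut]; have u0 : 0 < u by exact: lt_trans su.
    have Tu : T0 <= u by rewrite ltW // (lt_trans Ts).
    have TTu := le_trans TT0 Tu.
    have pu : 0 < u `^ gam by rewrite powR_gt0.
    have epu := mulr_gt0 eta0 pu.
    have := Dneg u; rewrite su (ltW ut) => /(_ isT) Du.
    have : `|D a1 u - D a1 s| < D a1 s by apply: rP; rewrite su /=; lra.
    rewrite ltr_norml => /andP[D1u _].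
    have := bT0 u Tu; rewrite ler_norml => /andP[bu1 bu2].
    have xu : 0 < x u.
      rewrite xJ //; move: D1u; rewrite /D /a1; move: (u `^ gam) (s `^ gam) epu bu1 => p q *.
      lra.
    rewrite gE // xu subr0 -drift_along_power // ler_pM2l //.
    apply: powR_antitone => //.
    rewrite xJ //; move: Du; rewrite /D /a2; move: (u `^ gam) bu2 => p *; lra.
  rewrite !subr0 /D.
  have : eta * (t `^ gam - s `^ gam) <= drift_slope alpha cp a2 * (t `^ gam - s `^ gam).
    by rewrite ler_wpM2r ?subr_ge0 // ltW.
  move: (t `^ gam) (s `^ gam) (drift_slope _ _ _) => p q k; lra.
exists (T0 + 1) => t Tt.
have {}Tt : T0 < t by apply: lt_le_trans Tt; rewrite ltrDl.
have Dt : D eta t < 0.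
  rewrite ltNge; apply/negP => Dt; apply: xosc; exists t => u tu.
  have Du := barrier_nonneg (cD eta) Tt Dt HD tu.
  have Tu : T0 <= u by exact: le_trans (ltW Tt) tu.
  have u0 : 0 < u by exact: lt_le_trans Tu.
  have pu : 0 < u `^ gam by rewrite powR_gt0.
  have := bT0 u Tu; rewrite ler_norml => /andP[bu1 _].
  rewrite xJ ?(le_trans TT0) //.
  by move: Du (mulr_gt0 eta0 pu); rewrite /D; move: (u `^ gam) bu1 => p *; lra.
have := bT0 t (ltW Tt); rewrite ler_norml => /andP[_ bu2].
rewrite xJ ?(le_trans TT0) ?(ltW Tt) //.
have pt : 0 <= t `^ gam by exact: powR_ge0.
have := ler_wpM2r pt eta_d; have := mulr_ge0 (ltW eta0) pt.
by move: Dt; rewrite /D; move: (t `^ gam) bu2 => p *; lra.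
Qed.

(** Nothing prevents the path from changing sign for ever by jumps, with
    [|x t|] tending to infinity; but it then is negligible with respect to
    [t ^ gam], in accordance with a limit path equal to 0. *)
Lemma asymptotic_oscillating T cp cm x J g b : sde_path alpha T cp cm x J g b ->
  alpha <= 0 -> 0 < cp -> 0 < cm -> negligible_noise alpha b ->
  ~ (exists T', forall t, T' <= t -> 0 < x t) ->
  ~ (exists T', forall t, T' <= t -> x t < 0) ->
  asymptotic_to alpha x 0.
Proof.
move=> xP al0 cp0 cm0 bn xp xm d d0.
have [T1 T1P] := oscillation_upper xP al0 cp0 cm0 bn xp d0.
have [|T2 T2P] := oscillation_upper (sde_pathN xP) al0 cm0 cp0 (negligible_noiseN bn) _ d0.
  by move=> [T' T'P]; apply: xm; exists T' => t /T'P; rewrite oppr_gt0.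
exists (Num.max T1 T2) => t; rewrite ge_max => /andP[/T1P t1 /T2P t2].
by rewrite mul0r subr0 ler_norml t1 andbT lerNl.
Qed.

Lemma littleo_pinftyP (f h : R -> R) : littleo_pinfty f h ->
  forall e, 0 < e -> exists T, 0 < T /\ forall t, T <= t -> `|f t| <= e * `|h t|.
Proof.
move=> fh e /fh [M [_ MP]]; exists (`|M| + 1); split; first by rewrite ltr_wpDl.
by move=> t Mt; apply: MP; rewrite (le_lt_trans (ler_norm M)) // (lt_le_trans _ Mt) // ltrDl.
Qed.

Lemma negligible_littleo b : littleo_pinfty b (fun t => t `^ gam) -> negligible_noise alpha b.
Proof.
move=> bo e /(littleo_pinftyP bo)[T [_ TP]]; exists T => t /TP.
by rewrite (ger0_norm (powR_ge0 _ _)).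
Qed.

(** As [h] may be unbounded near 0, the noise may be large just after [tn n]; the
    restarting times are the [tn n + M], for [M] past which
    [h u <= e * u ^ gam]. *)
Lemma restarts_littleo x b h (tn : nat -> R) :
  (forall K, exists T, forall t, T <= t -> K <= `|x t|) ->
  littleo_pinfty h (fun t => t `^ gam) ->
  (forall K, exists n, K <= tn n) ->
  (forall n t, tn n <= t -> `|b t - b (tn n)| <= h (t - tn n)) ->
  restarts alpha x b.
Proof.
move=> xinf hlo tninf bh eta eta0.
have p2 : 0 < 2 `^ gam :> R by rewrite powR_gt0.
have [M [M0 MP]] := littleo_pinftyP hlo (divr_gt0 eta0 p2).
pose e := eta / 2 `^ gam; have e0 : 0 < e by rewrite divr_gt0.
have hP u : M <= u -> h u <= e * u `^ gam.
  move=> /MP; rewrite (ger0_norm (powR_ge0 _ _)).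
  exact: le_trans (ler_norm _).
exists (e * (2 * M) `^ gam + e * M `^ gam) => K.
have [T TP] := xinf K.
have [n nP] := tninf (Num.max T K).
have [nT nK] : T <= tn n /\ K <= tn n by move: nP; rewrite ge_max => /andP.
exists (tn n + M); split.
- by rewrite (le_trans nK) // lerDl ltW.
- by apply: TP; rewrite (le_trans nT) // lerDl ltW.
move=> t st.
have tt : tn n <= t by apply: le_trans st; rewrite lerDl ltW.
have b1 : `|b t - b (tn n)| <= e * (t - tn n) `^ gam.
  by apply: (le_trans (bh n t tt)); apply: hP; rewrite lerBrDl.
have b2 : `|b (tn n + M) - b (tn n)| <= e * M `^ gam.
  apply: (le_trans (bh n _ _)); first by rewrite lerDl ltW.
  by rewrite addrC addKr; exact: hP.
have tri : `|b t - b (tn n + M)| <= `|b t - b (tn n)| + `|b (tn n + M) - b (tn n)|.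
  by rewrite -[`|b (tn n + M) - _|]distrC; exact: ler_distD.
pose v := t - (tn n + M); have v0 : 0 <= v by rewrite subr_ge0.
have vE : t - tn n = v + M by rewrite /v; ring.
have pv : (v + M) `^ gam <= 2 `^ gam * v `^ gam + (2 * M) `^ gam.
  rewrite -powRM //; have [vM|Mv] := leP v M.
    apply: (@le_trans _ _ ((2 * M) `^ gam)).
      by apply: le_powR_gam => //; [rewrite addr_ge0 // ltW | lra].
    by rewrite lerDr powR_ge0.
  apply: (@le_trans _ _ ((2 * v) `^ gam)).
    by apply: le_powR_gam => //; [rewrite addr_ge0 // ltW | lra].
  by rewrite lerDl powR_ge0.
have e2 : e * 2 `^ gam = eta by rewrite /e divfK // gt_eqF.
rewrite vE in b1; rewrite -/v -e2.
have := ler_wpM2l (ltW e0) pv; rewrite mulrDr mulrA.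
by move: b1 b2 tri; lra.
Qed.

Lemma drift_neq0 cp cm (y : R) : y != 0 ->
  drift cp cm alpha y =
  (if 0 < y then cp * y `^ alpha else - (cm * `|y| `^ alpha))%:E.
Proof.
move=> y0; rewrite /drift /abs_pow (negbTE y0) /= -EFinM; congr _%:E.
rewrite !indicE; case: (ltrgtP y 0) y0 => // y0 _.
- rewrite memNset /=; last by move=> /=; rewrite leNgt y0.
  by rewrite mem_set //= mulr0 mulr1 sub0r mulNr.
- rewrite mem_set /=; last exact: ltW.
  rewrite memNset /=; last by move=> /=; rewrite ltNge (ltW y0).
  by rewrite mulr1 mulr0 subr0 gtr0_norm.
Qed.

Lemma solves_sde_path T cp cm x b : 0 < T -> cadlag x ->
  (forall t, T <= t -> 1 <= `|x t|) -> solves cp cm alpha 1 x b ->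
  sde_path alpha T cp cm x (fun t => x t - b t)
    (fun u => fine (drift cp cm alpha (x u))) b.
Proof.
move=> T0 [xr _] x1 xb.
have xn0 u : T <= u -> x u != 0.
  by move=> /x1; apply: contraTneq => ->; rewrite normr0 ler10.
split=> //; first last.
- by move=> u Tu; rewrite drift_neq0 // xn0.
- by move=> u Tu; apply: xr; rewrite (le_trans (ltW T0)).
- by move=> u Tu; rewrite subrK.
move=> s t Ts st.
have s0 : 0 <= s by rewrite (le_trans (ltW T0)).
have t0 : 0 <= t by rewrite (le_trans s0).
have [it xt] := xb t t0; have [is_ xs] := xb s s0.
have gd : {in `[s, t]%classic, (fun u => drift cp cm alpha (x u)) =1
    EFin \o (fun u => fine (drift cp cm alpha (x u)))}.
  move=> u; rewrite inE /= in_itv /= => /andP[su _].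
  by rewrite drift_neq0 // xn0 // (le_trans Ts).
have ist : mu.-integrable `[s, t] (fun u => drift cp cm alpha (x u)).
  apply: integrableS it => // u /=; rewrite !in_itv /= => /andP[su ->].
  by rewrite (le_trans s0).
split; first by apply: eq_integrable ist => //; exact: gd.
transitivity (\int[mu]_(u in `[s, t]) drift cp cm alpha (x u))%E; last exact: eq_integral.
have split0 : (\int[mu]_(u in `[0%R, t]) drift cp cm alpha (x u) =
    \int[mu]_(u in `[0%R, s]) drift cp cm alpha (x u) +
    \int[mu]_(u in `[s, t]) drift cp cm alpha (x u))%E.
  rewrite (@itv_bndbnd_setU _ _ _ (BRight s)); [|by rewrite bnd_simp|by rewrite bnd_simp].
  rewrite integral_setU //.
  - congr (_ + _)%E; apply: integral_itv_obnd_cbnd.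
    by apply: measurable_funS (measurable_int _ ist) => //; exact: subset_itv_oc_cc.
  - rewrite -itv_bndbnd_setU ?bnd_simp //; exact: measurable_int it.
  - apply/disj_setPS => y [/=]; rewrite 2!in_itv/= => /andP[_ ys] /andP[].
    by rewrite ltNge ys.
have fs : (\int[mu]_(u in `[0%R, s]) drift cp cm alpha (x u))%E \is a fin_num.
  exact: integrable_fin_num.
have fst : (\int[mu]_(u in `[s, t]) drift cp cm alpha (x u))%E \is a fin_num.
  exact: integrable_fin_num.
move: xt xs; rewrite split0 !mul1r -(fineK fs) -(fineK fst) -!EFinD.
move=> [->] [->]; congr _%:E; lra.
Qed.

End long_time.

Section path_limits.
Variables (R : realType) (alpha : R).
Hypothesis alpha1 : alpha < 1.
Local Notation gam := ((1 - alpha)^-1).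
Implicit Types (x b h : R -> R) (cp cm c a t u T s C l : R).

Lemma cvg_pinftyP x : x t @[t --> +oo] --> +oo <->
  forall K, exists T, forall t, T <= t -> K <= x t.
Proof.
split=> [/cvgryPge xy K|H].
  have [M [_ MP]] := xy K; exists (M + 1) => t Mt; apply: MP.
  by rewrite (lt_le_trans _ Mt) // ltrDl.
apply/cvgryPge => K; have [T TP] := H K.
by exists T; split; [exact: num_real | move=> t /ltW /TP].
Qed.

Lemma cvg_ninftyP x : x t @[t --> +oo] --> -oo <->
  forall K, exists T, forall t, T <= t -> x t <= K.
Proof.
split=> [/cvgrNyPle xy K|H].
  have [M [_ MP]] := xy K; exists (M + 1) => t Mt; apply: MP.
  by rewrite (lt_le_trans _ Mt) // ltrDl.
apply/cvgrNyPle => K; have [T TP] := H K.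
by exists T; split; [exact: num_real | move=> t /ltW /TP].
Qed.

Lemma cvg_pinfty_sign x : `|x t| @[t --> +oo] --> +oo ->
  (exists T, forall t, T <= t -> 0 < x t) -> x t @[t --> +oo] --> +oo.
Proof.
move=> /cvg_pinftyP xy [T TP]; apply/cvg_pinftyP => K; have [T' T'P] := xy K.
exists (Num.max T T') => t; rewrite ge_max => /andP[/TP xt /T'P].
by rewrite gtr0_norm.
Qed.

Lemma cvg_ninfty_sign x : `|x t| @[t --> +oo] --> +oo ->
  (exists T, forall t, T <= t -> x t < 0) -> x t @[t --> +oo] --> -oo.
Proof.
move=> /cvg_pinftyP xy [T TP]; apply/cvg_ninftyP => K; have [T' T'P] := xy (- K).
exists (Num.max T T') => t; rewrite ge_max => /andP[/TP xt /T'P].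
by rewrite ltr0_norm // lerN2.
Qed.

Definition admissible_noise b :=
  (0 < alpha < 1 /\ exists h (tn : nat -> R),
     [/\ littleo_pinfty h (fun t => t `^ gam), tn n @[n --> \oo] --> +oo &
         forall n t, tn n <= t -> `|b t - b (tn n)| <= h (t - tn n)]) \/
  (-1 < alpha <= 0 /\ littleo_pinfty b (fun t => t `^ gam)).

Definition limit_coef cp cm x : R :=
  extremal_coef alpha cp * `[< x t @[t --> +oo] --> +oo >]%:R -
  extremal_coef alpha cm * `[< x t @[t --> +oo] --> -oo >]%:R.

Lemma pinfty_not_ninfty x : x t @[t --> +oo] --> +oo -> ~ x t @[t --> +oo] --> -oo.
Proof.
move=> /cvg_pinftyP /(_ 1)[T TP] /cvg_ninftyP /(_ 0)[T' T'P].
have := TP (Num.max T T'); rewrite le_max lexx => /(_ isT).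
have := T'P (Num.max T T'); rewrite le_max lexx orbT => /(_ isT).
by move: (x _) => y; lra.
Qed.

Lemma asymptotic_toN x l : asymptotic_to alpha (fun t => - x t) l -> asymptotic_to alpha x (- l).
Proof.
move=> xl d /xl [T TP]; exists T => t /TP.
by rewrite -normrN opprB mulNr !opprK addrC.
Qed.

(** For [alpha > 0] the sign of the path stabilises by itself; for [alpha <= 0]
    it need not, which is when [limit_coef] is 0. *)
Lemma path_asymptotics cp cm x b : 0 < cp -> 0 < cm -> cadlag x ->
  solves cp cm alpha 1 x b -> `|x t| @[t --> +oo] --> +oo ->
  admissible_noise b -> asymptotic_to alpha x (limit_coef cp cm x).
Proof.
move=> cp0 cm0 cx xb xy bn.
have xinf := (cvg_pinftyP (fun t => `|x t|)).1 xy.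
have [T [T0 x1]] : exists T, 0 < T /\ forall t, T <= t -> 1 <= `|x t|.
  have [T TP] := xinf 1; exists (Num.max T 1); split.
    by rewrite lt_max ltr01 orbT.
  by move=> t; rewrite ge_max => /andP[/TP].
have xP := solves_sde_path T0 cx x1 xb.
have pos : (exists T', forall t, T' <= t -> 0 < x t) ->
    asymptotic_to alpha x (extremal_coef alpha cp) ->
    asymptotic_to alpha x (limit_coef cp cm x).
  move=> xpos; have xp := cvg_pinfty_sign xy xpos.
  rewrite /limit_coef asboolT // asboolF; last exact: pinfty_not_ninfty.
  by rewrite mulr1 mulr0 subr0.
have neg : (exists T', forall t, T' <= t -> x t < 0) ->
    asymptotic_to alpha (fun t => - x t) (extremal_coef alpha cm) ->
    asymptotic_to alpha x (limit_coef cp cm x).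
  move=> xneg xa; have xn := cvg_ninfty_sign xy xneg.
  rewrite /limit_coef asboolF; last by move=> /pinfty_not_ninfty.
  by rewrite asboolT // mulr0 mulr1 sub0r; exact: asymptotic_toN.
case: bn => [[/andP[al0 _] [h [tn [hlo /cvgryPge tny bh]]]]|[/andP[_ al0] blo]].
  have xr : restarts alpha x b.
    apply: (restarts_littleo alpha1 xinf hlo) bh => K.
    by have [N _ NP] := tny K; exists N; exact: (NP N (leqnn N)).
  have [T' TT' [xpos|xneg]] := growth_dichotomy alpha1 xP (ltW al0) cp0 cm0 xr.
    apply: pos; first by exists T'.
    exact: (asymptotic_superlinear alpha1 (sde_pathS TT' xP) (ltW al0) cp0 xr).
  apply: neg; first by exists T'.
  apply: (asymptotic_superlinear alpha1 (sde_pathN (sde_pathS TT' xP)) (ltW al0) cm0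
    (restartsN xr)).
  by move=> t /xneg; rewrite oppr_gt0.
have bn := negligible_littleo blo.
have [[T' T'P]|xp] := pselect (exists T', forall t, T' <= t -> 0 < x t).
  apply: pos; first by exists T'.
  have TT' : T <= Num.max T T' by rewrite le_max lexx.
  apply: (asymptotic_sublinear alpha1 (sde_pathS TT' xP) al0 cp0 cm0 bn).
  by move=> t; rewrite ge_max => /andP[_ /T'P].
have [[T' T'P]|xm] := pselect (exists T', forall t, T' <= t -> x t < 0).
  apply: neg; first by exists T'.
  have TT' : T <= Num.max T T' by rewrite le_max lexx.
  apply: (asymptotic_sublinear alpha1 (sde_pathN (sde_pathS TT' xP)) al0 cm0 cp0
    (negligible_noiseN bn)).
  by move=> t; rewrite ge_max oppr_gt0 => /andP[_ /T'P].
rewrite /limit_coef asboolF; last first.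
  by move=> /cvg_pinftyP /(_ 1)[T' T'P]; apply: xp; exists T' => t /T'P; exact: lt_le_trans.
rewrite asboolF; last first.
  move=> /cvg_ninftyP /(_ (-1))[T' T'P]; apply: xm; exists T' => t /T'P.
  by move/le_lt_trans; apply; rewrite oppr_lt0.
rewrite !mulr0 subr0.
exact: (asymptotic_oscillating alpha1 xP).
Qed.

(** Zooming out: [l * t ^ gam] is invariant under the scaling which takes [x] to
    the path with noise of size [lam]. *)
Lemma asymptotic_to_rescaled x l M d : cadlag x -> asymptotic_to alpha x l -> 0 < d ->
  exists2 lam0, 0 < lam0 & forall lam, 0 < lam < lam0 -> forall t, 0 <= t <= M ->
    `|lam * x ((lam `^ (1 - alpha))^-1 * t) - l * t `^ gam| < d.
Proof.
move=> cx xl d0.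
have al0 : 1 - alpha != 0 by rewrite subr_eq0 gt_eqF.
pose P := `|M| `^ gam + 1.
have P0 : 0 < P by rewrite ltr_wpDl ?powR_ge0.
pose e := d / 2 / P; have e0 : 0 < e by rewrite !divr_gt0.
have eP : e * P = d / 2 by rewrite /e divfK // gt_eqF.
have [T TP] := xl e e0.
have [C CP] := cadlag_bounded `|T| cx.
have n1 : 0 <= `|C| by []. have n2 : 0 <= `|l| * `|T| `^ gam by rewrite mulr_ge0 ?powR_ge0.
pose B := `|C| + `|l| * `|T| `^ gam + 1.
have B0 : 0 < B by rewrite /B; lra.
have xB u : 0 <= u -> `|x u - l * u `^ gam| <= B + e * u `^ gam.
  move=> u0; have eu : 0 <= e * u `^ gam by rewrite mulr_ge0 ?powR_ge0 // ltW.
  have [Tu|uT] := leP T u; first by have := TP u Tu; rewrite /B; lra.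
  have uT' : u <= `|T| by rewrite (le_trans (ltW uT)) // ler_norm.
  have xu : `|x u| <= `|C| by rewrite (le_trans _ (ler_norm C)) // CP // u0.
  have lu : `|l * u `^ gam| <= `|l| * `|T| `^ gam.
    rewrite normrM ler_wpM2l // ger0_norm ?powR_ge0 //; exact: le_powR_gam.
  by have := ler_normB (x u) (l * u `^ gam); rewrite /B; lra.
exists (d / 2 / B); first by rewrite !divr_gt0.
move=> lam /andP[lam0 lamB] t /andP[t0 tM].
set c := lam `^ (1 - alpha); have c0 : 0 < c by rewrite powR_gt0.
have cg : c `^ gam = lam by rewrite /c -powRrM divff // powRr1 // ltW.
set u := c^-1 * t; have u0 : 0 <= u by rewrite mulr_ge0 // invr_ge0 ltW.
have lu : lam * u `^ gam = t `^ gam.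
  rewrite -cg -powRM //; last exact: ltW.
  by rewrite /u mulVKf // gt_eqF.
have -> : lam * x u - l * t `^ gam = lam * (x u - l * u `^ gam).
  by rewrite mulrBr [lam * (l * _)]mulrCA lu.
rewrite normrM (gtr0_norm lam0).
have lB : lam * B < d / 2 by rewrite -ltr_pdivlMr.
have tP : t `^ gam <= P.
  have : t `^ gam <= `|M| `^ gam.
    by apply: le_powR_gam => //; rewrite (le_trans tM) // ler_norm.
  by rewrite /P; lra.
have := ler_wpM2l (ltW lam0) (xB u u0); rewrite mulrDr [lam * (e * _)]mulrCA lu.
by have := ler_wpM2l (ltW e0) tP; rewrite eP; lra.
Qed.

End path_limits.

(** * Rescaling of weak solutions *)

Section rescaling.
Variable R : realType.
Local Notation mu := (@lebesgue_measure R).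
Implicit Types (f x b : R -> R) (a c t s : R).

Lemma skorokhod_ext (f g : skorokhod R) : (forall t, f t = g t) -> f = g.
Proof.
case: f g => [f cf nf] [g cg ng] /= fg.
have e : f = g by apply/funext.
by rewrite e in cf nf *; congr Skorokhod; exact: Prop_irrelevance.
Qed.

Lemma cadlag_rescale a c f : 0 < c -> cadlag f -> cadlag (fun t => a * f (c * t)).
Proof.
move=> c0 [fr fl].
have bd (u e : R) : 0 < e -> `|u| < e / (`|a| + 1) -> `|a * u| < e.
  move=> e0; rewrite ltr_pdivlMr ?ltr_wpDl // => ue; rewrite normrM mulrC.
  by apply: le_lt_trans ue; rewrite ler_wpM2l // lerDl.
have pos (e : R) : 0 < e -> 0 < e / (`|a| + 1).
  by move=> e0; rewrite divr_gt0 // ltr_wpDl.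
have cr (r : R) : 0 < r -> c * (r / c) = r by move=> r0; rewrite mulrC divfK ?gt_eqF.
split=> t t0.
  have ct0 : 0 <= c * t by rewrite mulr_ge0 // ltW.
  apply: cvg_at_rightPlt => e e0.
  have [r r0 rP] := cvg_at_right_ltP (fr _ ct0) (pos e e0).
  exists (r / c); first by rewrite divr_gt0.
  move=> s /andP[ts st]; rewrite -mulrBr; apply: bd => //; apply: rP.
  by rewrite ltr_pM2l // ts -(cr r r0) -mulrDr ltr_pM2l.
have ct0 : 0 < c * t by rewrite mulr_gt0.
apply/cvg_ex; exists (a * lim (f s @[s --> (c * t)^'-])).
apply: cvg_at_leftPlt => e e0.
have [r r0 rP] := cvg_at_left_ltP (fl _ ct0) (pos e e0).
exists (r / c); first by rewrite divr_gt0.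
move=> s /andP[ts st]; rewrite -mulrBr; apply: bd => //; apply: rP.
by rewrite ltr_pM2l // st andbT -(cr r r0) -mulrBr ltr_pM2l.
Qed.

Lemma rescale_neg a c (f : skorokhod R) : 0 < c ->
  forall t, t < 0 -> a * f (c * t) = 0.
Proof. by move=> c0 t t0; rewrite skorokhod_neg ?mulr0 // pmulr_rlt0. Qed.

Definition rescale a c (c0 : 0 < c) (f : skorokhod R) : skorokhod R :=
  Skorokhod (cadlag_rescale a c0 (skorokhod_cadlag f)) (rescale_neg a f c0).

Lemma measurable_rescale a c (c0 : 0 < c) :
  measurable_fun [set: path_space R] (rescale a c0 : path_space R -> path_space R).
Proof.
apply: measurable_to_paths => t /=.
by apply: measurable_funM => //; exact: measurable_coordinate.
Qed.

Lemma drift_homogeneous cp cm alpha r (y : R) : 0 < r ->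
  drift cp cm alpha (r * y) = ((r `^ alpha)%:E * drift cp cm alpha y)%E.
Proof.
move=> r0; rewrite /drift muleCA; congr (_ * _)%E.
  have e1 : (r * y \in [set z : R | 0 <= z]) = (y \in [set z : R | 0 <= z]).
    by apply/idP/idP; rewrite !inE /= pmulr_rge0.
  have e2 : (r * y \in [set z : R | z < 0]) = (y \in [set z : R | z < 0]).
    by apply/idP/idP; rewrite !inE /= pmulr_rlt0.
  by rewrite !indicE e1 e2.
rewrite /abs_pow mulf_eq0 (gt_eqF r0) /=; case: ifP => _.
  by rewrite gt0_muley // lte_fin powR_gt0.
by rewrite normrM powRM // (gtr0_norm r0) EFinM.
Qed.

Lemma solves_rescale cp cm alpha lam c e k x b : 0 < lam -> c = lam `^ (1 - alpha) ->
  k = lam^-1 * e -> solves cp cm alpha e x b ->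
  solves cp cm alpha 1 (fun t => lam^-1 * x (c * t)) (fun t => k * b (c * t)).
Proof.
move=> lam0 cE kE xb t t0; have c0 : 0 < c by rewrite cE powR_gt0.
have ct0 : 0 <= c * t by rewrite mulr_ge0 // ltW.
have [ix xt] := xb _ ct0.
have lamV : 0 < lam^-1 by rewrite invr_gt0.
pose D u := drift cp cm alpha (x u).
have dE : (fun s => drift cp cm alpha (lam^-1 * x (c * s))) =
    (fun s => ((lam^-1 `^ alpha)%:E * D (c * s)%R)%E).
  by apply/funext => s; exact: drift_homogeneous.
have itvE : `[0, c * t]%classic = `[c * 0, c * t]%classic by rewrite mulr0.
have iD : mu.-integrable `[0, t] (fun s => D (c * s)).
  have /integrableP[mD fD] := ix; apply/integrableP; split.
    apply: (@measurable_comp _ _ _ _ _ _ `[0, c * t]%classic D) => //.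
      move=> _ [s /= + <-]; rewrite !in_itv /= => /andP[s0 st].
      by rewrite mulr_ge0 ?ler_pM2l // ltW.
  move: fD; rewrite itvE (integral_dilation_itvcc _ _ _ c0).
  by rewrite -lte_pdivlMl // => /lt_le_trans; apply; rewrite leey.
split.
  by rewrite dE; exact: integrableZl.
rewrite dE integralZl //.
have xE : (\int[mu]_(u in `[0%R, (c * t)%R]) D u = c%:E * \int[mu]_(s in `[0%R, t]) D (c * s)%R)%E.
  by rewrite itvE (integral_dilation_itvcc _ _ _ c0).
have iE : (\int[mu]_(s in `[0%R, t]) D (c * s)%R)%E \is a fin_num.
  exact: integrable_fin_num.
have : (x (c * t))%:E = (\int[mu]_(u in `[0%R, (c * t)%R]) D u + (e * b (c * t))%:E)%E.
  exact: xt.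
move=> {xt}; rewrite xE -(fineK iE) -EFinM -EFinD => -[xt].
rewrite -EFinM -EFinD xt; move: (fine _) => I; congr _%:E; rewrite kE mul1r.
have lc : lam^-1 `^ alpha = lam^-1 * c.
  rewrite cE powRB; last by rewrite (gt_eqF lam0) implybT.
  rewrite powRr1 ?(ltW lam0) // mulKf ?gt_eqF //.
  by rewrite -[X in X `^ _]powR_inv1 ?(ltW lam0) // -powRrM mulN1r powRN.
by rewrite lc mulrDr; ring.
Qed.

End rescaling.

Section rescaled_laws.
Variable R : realType.
Local Notation mu := (@lebesgue_measure R).

Section one_space.
Context d (T : measurableType d) (P : probability T R).
Implicit Types (F : R -> set_system T) (X : T -> R -> R) (a c : R).

Lemma measurable_dilate (A : set R) a : measurable A ->
  measurable [set y | A (a * y)].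
Proof.
move=> mA; rewrite -[X in measurable X]setTI.
exact: (measurable_funM (@measurable_cst _ _ _ _ setT a) (@measurable_id _ _ setT)).
Qed.

Lemma filtration_rescale F c : 0 < c -> filtration F -> filtration (fun s => F (c * s)).
Proof.
move=> c0 [Fs Fm Fi]; split.
- by move=> t t0; apply: Fs; rewrite mulr_ge0 // ltW.
- by move=> t t0; apply: Fm; rewrite mulr_ge0 // ltW.
- by move=> s t s0 st; apply: Fi; rewrite ?mulr_ge0 ?ler_pM2l // ltW.
Qed.

Lemma adapted_rescale F X a c : 0 < c -> adapted F X ->
  adapted (fun s => F (c * s)) (fun w t => a * X w (c * t)).
Proof.
move=> c0 FX t t0 A mA.
have ct0 : 0 <= c * t by rewrite mulr_ge0 // ltW.
exact: (FX _ ct0 _ (measurable_dilate a mA)).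
Qed.

Lemma increments_rescale F X a c : 0 < c -> increments_indep_of_past P F X ->
  increments_indep_of_past P (fun s => F (c * s)) (fun w t => a * X w (c * t)).
Proof.
move=> c0 FX s t s0 st A E mA FE.
have cs0 : 0 <= c * s by rewrite mulr_ge0 // ltW.
have cst : c * s <= c * t by rewrite ler_pM2l.
have := FX _ _ cs0 cst _ E (measurable_dilate a mA) FE.
have -> : [set w | A (a * X w (c * t) - a * X w (c * s))] =
    [set w | [set y | A (a * y)] (X w (c * t) - X w (c * s))].
  by apply/funext => w /=; rewrite mulrBr.
by [].
Qed.

Lemma adapted_measurable F X : filtration F -> adapted F X ->
  forall t, 0 <= t -> measurable_fun [set: T] (fun w => X w t).
Proof.
by move=> [_ Fm _] FX t t0 _ A mA; rewrite setTI; apply: (Fm t t0); exact: FX.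
Qed.

Lemma process_measurable (X : T -> skorokhod R) : process X ->
  measurable_fun [set: T] (X : T -> path_space R).
Proof.
move=> mX; apply: measurable_to_paths => t; have [t0|t0] := leP 0 t; first exact: mX.
rewrite (_ : (fun w => _) = cst 0) //.
by apply/funext => w; rewrite skorokhod_neg.
Qed.

Lemma F_levy_rescale F (B : T -> skorokhod R) a c (c0 : 0 < c) :
  F_levy P F B -> F_levy P (fun s => F (c * s)) (fun w => rescale a c0 (B w)).
Proof.
move=> [FB B0 iB sB]; split.
- exact: (@adapted_rescale F (fun w t => B w t) a c c0 FB).
- by apply: filterS B0 => w /= B0; rewrite mulr0 B0 mulr0.
- exact: (@increments_rescale F (fun w t => B w t) a c c0 iB).
- move=> s t s0 st A mA /=.
  have cs0 : 0 <= c * s by rewrite mulr_ge0 // ltW.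
  have cst : c * s <= c * t by rewrite ler_pM2l.
  have := sB _ _ cs0 cst _ (measurable_dilate a mA); rewrite -mulrBr => /= <-.
  congr (P _); apply/funext => w /=; by rewrite mulrBr.
Qed.

Lemma normal_prob_dilate (A : set R) (s r : R) : 0 < r -> s != 0 -> measurable A ->
  normal_prob 0 s [set y | A (r * y)] = normal_prob 0 (r * s) A.
Proof.
move=> r0 s0 mA; rewrite /normal_prob [RHS](integral_dilation _ _ r0).
rewrite -ge0_integralZl //=; last 4 first.
- exact: (measurable_dilate r mA).
- apply/measurable_EFinP; apply: measurableT_comp; first exact: measurable_normal_pdf.
  exact: measurable_funM.
- by move=> x _; rewrite lee_fin normal_pdf_ge0.
- by rewrite lee_fin ltW.
apply: eq_integral => x _; rewrite -EFinM; congr _%:E.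
have rs0 : r * s != 0 by rewrite mulf_neq0 // gt_eqF.
rewrite !normal_pdfE // mulrA; congr (_ * _); last first.
  rewrite /normal_fun !subr0; congr expR.
  have rn0 : r != 0 by rewrite gt_eqF.
  have -> : - (r * x) ^+ 2 / ((r * s) ^+ 2 *+ 2) =
      (r ^+ 2 / r ^+ 2) * (- x ^+ 2 / (s ^+ 2 *+ 2)).
    by rewrite mulf_div !exprMn mulrN mulrnAr.
  by rewrite divff ?mul1r // expf_neq0.
rewrite /normal_peak.
have -> : (r * s) ^+ 2 * pi *+ 2 = r ^+ 2 * (s ^+ 2 * pi *+ 2).
  by rewrite exprMn -mulrA mulrnAr.
by rewrite (sqrtrM _ (sqr_ge0 r)) sqrtr_sqr (gtr0_norm r0) invfM mulrA divff ?gt_eqF // mul1r.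
Qed.

Lemma has_normal_law_rescale (Z : T -> R) (s r : R) : 0 < r ->
  has_normal_law P 0 s Z -> has_normal_law P 0 (r * s) (fun w => r * Z w).
Proof.
move=> r0 ZN A mA.
have := ZN _ (measurable_dilate r mA); rewrite mulf_eq0 (gt_eqF r0) /= => ->.
case: ifPn => [s0|s0]; last exact: normal_prob_dilate.
rewrite /dirac /= !indicE.
have -> : (0 \in [set y | A (r * y)]) = (0 \in A) by apply/idP/idP; rewrite !inE /= mulr0.
by [].
Qed.

Lemma F_brownian_rescale F (W : T -> R -> R) c : 0 < c -> F_brownian P F W ->
  F_brownian P (fun s => F (c * s)) (fun w t => (Num.sqrt c)^-1 * W w (c * t)).
Proof.
move=> c0 [FW W0 cW iW nW]; split.
- exact: adapted_rescale.
- by apply: filterS W0 => w /= W0; rewrite mulr0 W0 mulr0.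
- apply: filterS cW => w /continuous_within_itvcyP[cW rW].
  apply/continuous_within_itvcyP; split.
    move=> t; rewrite in_itv /= andbT => t0; apply: cvgMr.
    apply: (@cvg_comp _ _ _ ( *%R c) (W w) _ (nbhs (c * t))).
      by apply: cvgMr; exact: cvg_id.
    by apply: cW; rewrite in_itv /= andbT mulr_gt0.
  apply: cvgMr; apply: cvg_at_rightPlt => e e0.
  have [r r0 rP] := cvg_at_right_ltP rW e0.
  exists (r / c); first by rewrite divr_gt0.
  move=> s /andP[s0 sr]; rewrite mulr0; apply: rP.
  by rewrite mulr_gt0 //= !add0r -ltr_pdivlMl // mulrC in sr *.
- exact: increments_rescale.
- move=> s t s0 st.
  have cs0 : 0 <= c * s by rewrite mulr_ge0 // ltW.
  have cst : c * s <= c * t by rewrite ler_pM2l.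
  have sc0 : 0 < (Num.sqrt c)^-1 by rewrite invr_gt0 sqrtr_gt0.
  have := has_normal_law_rescale sc0 (nW _ _ cs0 cst).
  rewrite -mulrBr sqrtrM ?(ltW c0) // mulKf ?gt_eqF ?sqrtr_gt0 //.
  rewrite (_ : (fun w => _) = (fun w =>
     (Num.sqrt c)^-1 * W w (c * t) - (Num.sqrt c)^-1 * W w (c * s))) //.
  by apply/funext => w; rewrite mulrBr.
Qed.

End one_space.
End rescaled_laws.

Section volterra_scaling.
Variable R : realType.
Local Notation mu := (@lebesgue_measure R).
Implicit Types (c H s t p q u : R).

Import HBNNSimple.

(** As in [ge0_integralT_dilation], homogeneity is read off the simple functions
    below the integrand. *)
Lemma ge0_integralZl_lower (D : set R) (k : R) (g : R -> \bar R) : 0 < k ->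
  (forall x, 0 <= g x)%E ->
  (\int[mu]_(x in D) (k%:E * g x) = k%:E * \int[mu]_(x in D) g x)%E.
Proof.
have le (r : R) (f : R -> \bar R) : 0 < r -> (forall x, 0 <= f x)%E ->
    (\int[mu]_x (r%:E * f x) <= r%:E * \int[mu]_x f x)%E.
  move=> r0 f0; have r1 : 0 <= r^-1 by rewrite invr_ge0 ltW.
  have rf0 x : (0 <= r%:E * f x)%E by rewrite mule_ge0 // lee_fin ltW.
  rewrite !ge0_integralTE //.
  apply: ge_ereal_sup => _ [h /= hf <-].
  rewrite -lee_pdivrMl // -(sintegralrM _ r^-1 h).
  apply: ereal_sup_ubound; exists (scale_nnsfun h r1) => //= x.
  by rewrite EFinM lee_pdivrMl.
have eq0 (r : R) (f : R -> \bar R) : 0 < r -> (forall x, 0 <= f x)%E ->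
    (\int[mu]_x (r%:E * f x) = r%:E * \int[mu]_x f x)%E.
  move=> r0 f0; apply/le_anti; rewrite le //=.
  have rf0 x : (0 <= r%:E * f x)%E by rewrite mule_ge0 // lee_fin ltW.
  rewrite -lee_pdivlMl //; apply: le_trans (le _ _ _ rf0); last by rewrite invr_gt0.
  under [leRHS]eq_integral do rewrite muleA -EFinM mulVf ?gt_eqF // mul1e.
  by [].
move=> k0 g0; rewrite integral_mkcond [in RHS]integral_mkcond -eq0 //; last first.
  by move=> x; rewrite /patch; case: ifP.
by apply: eq_integral => x _; rewrite /patch; case: ifP => // _; rewrite mule0.
Qed.

Lemma fine_EFinM (k : R) (x : \bar R) : 0 < k -> fine (k%:E * x)%E = k * fine x.
Proof.
by move=> k0; case: x => [x| |] //=; rewrite ?gt0_muley ?gt0_muleNy ?lte_fin //= mulr0.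
Qed.

Lemma kernel_integral_dilation c s t p q : 0 < c -> 0 <= s ->
  \int[mu]_(u in `[c * s, c * t]) ((u - c * s) `^ p * u `^ q) =
  c `^ (p + q + 1) * \int[mu]_(u in `[s, t]) ((u - s) `^ p * u `^ q).
Proof.
move=> c0 s0; rewrite /Rintegral (integral_dilation_itvcc _ _ _ c0).
have k0 : 0 < c `^ (p + q + 1) by rewrite powR_gt0.
rewrite -[RHS]fine_EFinM //; congr fine.
pose g u := ((c * u - c * s) `^ p * (c * u) `^ q)%:E.
pose h u := ((u - s) `^ p * u `^ q)%:E.
have g0 u : (0 <= g u)%E by rewrite lee_fin mulr_ge0 ?powR_ge0.
have h0 u : (0 <= h u)%E by rewrite lee_fin mulr_ge0 ?powR_ge0.
transitivity (\int[mu]_(u in `[s, t]) (c%:E * g u))%E.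
  by rewrite (ge0_integralZl_lower `[s, t]%classic c0 g0).
transitivity (\int[mu]_(u in `[s, t]) ((c `^ (p + q + 1))%:E * h u))%E; last first.
  by rewrite (ge0_integralZl_lower `[s, t]%classic k0 h0).
apply: eq_integral => u; rewrite inE /= in_itv /= => /andP[su _].
rewrite -!EFinM; congr _%:E.
have u0 : 0 <= u by exact: le_trans su.
have c0' := ltW c0.
rewrite -mulrBr !powRM ?subr_ge0 //.
rewrite !powRD ?(gt_eqF c0) ?implybT // powRr1 //.
move: (c `^ p) (c `^ q) ((u - s) `^ p) (u `^ q) => w x y z.
ring.
Qed.

(** Substituting [c * u] for [u] in the integrals yields [c ^ (2 * H - 1)], and the
    power of [s] in front of them yields [c ^ (1 / 2 - H)]. *)
Lemma volterra_kernel_dilation H c s t : 0 < c -> 0 <= s <= t ->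
  volterra_kernel H (c * t) (c * s) = c `^ (H - 1 / 2) * volterra_kernel H t s.
Proof.
move=> c0 /andP[s0 st]; have c0' := ltW c0.
have cn : c != 0 by rewrite gt_eqF.
rewrite /volterra_kernel.
have [/eqP e|H12] := boolP (H == 1 / 2).
  by rewrite e subrr powRr0 mulr1.
have pw (k : R) : c `^ (1 / 2 - H) * c `^ k = c `^ (1 / 2 - H + k).
  by rewrite -powRD // cn implybT.
have [H1|H1] := boolP (1 / 2 < H).
  rewrite kernel_integral_dilation // powRM //.
  have := pw (H - 3 / 2 + (H - 1 / 2) + 1).
  rewrite (_ : 1 / 2 - H + _ = H - 1 / 2); last by field.
  move=> <-; ring.
have swap (a b : R) : \int[mu]_(u in `[a, b]) (u `^ (H - 3 / 2) * (u - a) `^ (H - 1 / 2)) =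
    \int[mu]_(u in `[a, b]) ((u - a) `^ (H - 1 / 2) * u `^ (H - 3 / 2)).
  by apply: eq_Rintegral => u _; rewrite mulrC.
have e : c * t / (c * s) = t / s by rewrite -mulf_div divff // mul1r.
rewrite e; move: (t / s) => ts.
rewrite !swap kernel_integral_dilation // -mulrBr !powRM ?subr_ge0 //.
have := pw (H - 1 / 2 + (H - 3 / 2) + 1).
rewrite (_ : 1 / 2 - H + _ = H - 1 / 2); last by field.
move=> <-; ring.
Qed.

Lemma step_fun_dilation (n : nat) (p a : nat -> R) c (r u : R) : 0 < c ->
  step_fun n (fun i => p i / c) (fun i => r * a i) u = r * step_fun n p a (c * u).
Proof.
move=> c0; rewrite /step_fun mulr_sumr; apply: eq_bigr => i _.
rewrite mulrA; congr (_ * _); rewrite !indicE.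
have -> : (u \in `](p i / c), (p i.+1 / c)]%classic) = (c * u \in `](p i), (p i.+1)]%classic).
  apply/idP/idP; rewrite !inE /= !in_itv /=.
    by rewrite ltr_pdivrMr // ler_pdivlMr // mulrC.
  by rewrite ltr_pdivrMr // ler_pdivlMr // [u * c]mulrC.
by [].
Qed.

Section wiener.
Context d (T : measurableType d) (P : probability T R).

Lemma is_wiener_integral_rescale (W : T -> R -> R) (t c q r : R) (f f' : R -> R)
    (Z : T -> R) : 0 < c -> 0 <= t ->
  (forall s, 0 <= s -> measurable_fun setT (fun w => W w s)) ->
  measurable_fun setT Z ->
  0 < r -> (forall u, 0 <= u <= t -> f' u = r * f (c * u)) ->
  is_wiener_integral P W (c * t) f Z ->
  is_wiener_integral P (fun w s => q * W w (c * s)) t f' (fun w => r * q * Z w).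
Proof.
move=> c0 t0 mW mZ r0 ff' [n [p [a [pP fP ZP]]]].
have cn : c != 0 by rewrite gt_eqF.
exists n, (fun k i => p k i / c), (fun k i => r * a k i); split.
- move=> k i j /(pP k)[p0 /andP[pij pt]]; split; first by rewrite divr_ge0 // ltW.
  by rewrite ler_pM2r ?invr_gt0 // pij /= ler_pdivrMr // mulrC.
- rewrite (_ : (fun k => _) = (fun k => ((r ^+ 2 / c)%:E *
     \int[mu]_(s in `[0%R, (c * t)%R])
       ((step_fun (n k) (p k) (a k) s - f s) ^+ 2)%:E)%E)).
    by rewrite -(mule0 (r ^+ 2 / c)%:E); exact: cvgeZl.
  apply/funext => k.
  have itvE : `[0, c * t]%classic = `[c * 0, c * t]%classic by rewrite mulr0.
  rewrite itvE (integral_dilation_itvcc _ _ _ c0) muleA -EFinM divfK //.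
  rewrite -ge0_integralZl_lower ?exprn_gt0 //; last first.
    by move=> x; rewrite lee_fin sqr_ge0.
  apply: eq_integral => u; rewrite inE /= in_itv /= => ut.
  by rewrite step_fun_dilation // ff' // -mulrBr exprMn.
- rewrite (_ : (fun k => _) = (fun k => (((r * q) ^+ 2)%:E *
     'E_P[fun w => ((step_integral (n k) (p k) (a k) (W w) - Z w) ^+ 2)%R])%E)).
    by rewrite -(mule0 ((r * q) ^+ 2)%:E); exact: cvgeZl.
  apply/funext => k; rewrite unlock.
  have mS : measurable_fun setT (fun w => step_integral (n k) (p k) (a k) (W w)).
    apply: measurable_sum => i; apply: measurable_funM => //.
    have pi0 (j : nat) : (j <= n k)%N -> 0 <= p k j.
      by move=> jn; have [|//] := pP k j j; rewrite leqnn.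
    by apply: measurable_funB; apply: mW; apply: pi0 => //; exact: ltnW.
  rewrite -ge0_integralZl //; last 3 first.
  - apply/measurable_EFinP; apply: measurable_funX; exact: measurable_funB.
  - by move=> w _; rewrite lee_fin sqr_ge0.
  - by rewrite lee_fin sqr_ge0.
  apply: eq_integral => w _; rewrite -EFinM; congr _%:E; rewrite -exprMn; congr (_ ^+ 2).
  rewrite mulrBr; congr (_ - _); rewrite /step_integral mulr_sumr.
  apply: eq_bigr => i _; rewrite -mulrBr.
  have cp j : c * (p k j / c) = p k j by rewrite mulrC divfK.
  by rewrite !cp; ring.
Qed.

End wiener.
End volterra_scaling.

Section fractional_law.
Variable R : realType.
Context d (T : measurableType d) (P : probability T R).
Context d' (T' : measurableType d') (P' : probability T' R).

Lemma fractional_brownian_law H (X : T -> skorokhod R) (X' : T' -> skorokhod R) :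
  process X -> process X' -> same_path_law P P' X X' ->
  fractional_brownian P' H X' -> fractional_brownian P H X.
Proof.
move=> /process_measurable mX /process_measurable mX' XX' [H01 N E0 EE]; split=> //.
- move=> n a t t0; have [m [sigma Z]] := N n a t t0; exists m, sigma => A mA.
  rewrite -(Z A mA).
  have mS : measurable_fun [set: path_space R]
      (fun x : path_space R => \sum_(i < n) a i * (x : skorokhod R) (t i)).
    apply: measurable_sum => i; apply: measurable_funM => //.
    exact: measurable_coordinate.
  have mU := mS measurableT A mA; rewrite setTI in mU.
  exact: (XX' _ mU).
- move=> t t0; rewrite -(E0 t t0).
  exact: (expectation_path_law mX mX' (@measurable_coordinate R t) XX').
- move=> s t s0 t0; rewrite -(EE s t s0 t0).
  have m2 : measurable_fun [set: path_space R]
      (fun x : path_space R => (x : skorokhod R) s * (x : skorokhod R) t).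
    by apply: measurable_funM; exact: measurable_coordinate.
  exact: (expectation_path_law mX mX' m2 XX').
Qed.

End fractional_law.

Section self_similarity.
Variable R : realType.
Context d0 (T0 : measurableType d0) (P0 : probability T0 R).
Variables (beta : R) (B0 : T0 -> skorokhod R).
Hypotheses (hB0 : process B0) (hself : self_similar P0 beta B0).

Lemma self_similar_path_law c (c0 : 0 < c) :
  same_path_law P0 P0 (fun w => rescale (c `^ (- beta)) c0 (B0 w)) B0.
Proof.
have e1 : same_path_law P0 P0 (fun w => rescale 1 c0 (B0 w))
    (fun w => rescale (c `^ beta) ltr01 (B0 w)).
  apply/same_path_lawP.
  have := hself c0; congr (same_law P0 P0 _ _); apply/funext => t; apply/funext => w /=.
    by rewrite mul1r.
  by rewrite mul1r.
have := same_path_law_comp (measurable_rescale (c `^ (- beta)) ltr01) e1.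
congr (same_path_law P0 P0 _ _); apply/funext => w; apply: skorokhod_ext => t /=.
  by rewrite !mul1r.
by rewrite !mul1r mulrA powRN mulVf ?mul1r // powR_eq0 (gt_eqF c0).
Qed.

(** The two scalings of the variance, [t ^ (2 * H)] and [t ^ (2 * beta)], are
    compared at [t = 2]. *)
Lemma fractional_self_similar_index H : fractional_brownian P0 H B0 -> H = beta.
Proof.
move=> [/andP[H0 _] _ _ EE].
have two0 : 0 < 2 :> R by [].
have mB := process_measurable hB0.
have m1 : measurable_fun [set: path_space R]
    (fun x : path_space R => (x : skorokhod R) 1 * (x : skorokhod R) 1).
  by apply: measurable_funM; exact: measurable_coordinate.
have mrB : measurable_fun setT (fun w => rescale (2 `^ (- beta)) two0 (B0 w) : path_space R).
  exact: (measurableT_comp (measurable_rescale _ two0) mB).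
have := expectation_path_law mrB mB m1 (self_similar_path_law two0).
have E1 : ('E_P0[fun w => (B0 w 1 * B0 w 1)%R] = 1)%E.
  rewrite EE // subrr normr0 powR1 powR0 ?mulf_neq0 ?gt_eqF // subr0.
  by congr _%:E; field.
have E2 : ('E_P0[fun w => (B0 w 2 * B0 w 2)%R] = (2 `^ (2 * H))%:E)%E.
  rewrite EE // subrr normr0 powR0 ?mulf_neq0 ?gt_eqF // subr0.
  by congr _%:E; field.
have mBB : measurable_fun setT (fun w => ((B0 w 2 * B0 w 2)%:E)).
  by apply/measurable_EFinP; apply: measurable_funM; exact: hB0.
move=> /esym; rewrite [LHS]E1 unlock => EB.
have : (1 = ((2 `^ (- beta)) ^+ 2)%:E * (2 `^ (2 * H))%:E :> \bar R)%E.
  rewrite -E2 unlock -ge0_integralZl //; last first.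
    by move=> w _; rewrite lee_fin -expr2 sqr_ge0.
  rewrite EB; apply: eq_integral => w _ /=; rewrite -EFinM; congr _%:E.
  by rewrite mulr1; ring.
rewrite -EFinM => -[] /(congr1 (@ln R)).
rewrite ln1 lnM ?posrE ?exprn_gt0 ?powR_gt0 // expr2 lnM ?posrE ?powR_gt0 // !ln_powR.
have ln2 : 0 < ln (2 : R) by rewrite ln_gt0 // ltr1n.
move=> e; have : (H - beta) * ln 2 = 0 by lra.
by move=> /eqP; rewrite mulf_eq0 (gt_eqF ln2) orbF subr_eq0 => /eqP.
Qed.

(** Space is contracted by [lam] and time by [c = lam ^ (1 - alpha)], which
    leaves the drift invariant; [lam] is chosen so that self-similarity restores
    the law of the noise. The filtration runs at the speed [c], and the Levy and
    fractional Brownian properties with respect to it are inherited, the latter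
    through the Brownian scaling of the underlying Brownian motion. *)
Lemma weak_solution_rescale cp cm alpha e lam c k (c0 : 0 < c)
    d (T : measurableType d) (P : probability T R)
    (F : R -> set_system T) (X B : T -> skorokhod R) :
  0 < lam -> c = lam `^ (1 - alpha) -> k = c `^ (- beta) -> k = lam^-1 * e ->
  weak_solution cp cm alpha e P0 B0 P F X B ->
  weak_solution cp cm alpha 1 P0 B0 P (fun s => F (c * s))
    (fun w => rescale lam^-1 c0 (X w)) (fun w => rescale k c0 (B w)).
Proof.
move=> lam0 cE kb ke [[FF FX FB] XB BB0 levyB fbmB].
have hB : process B by exact: (@adapted_measurable _ _ _ _ (fun w t => B w t) FF FB).
have hkB : process (fun w => rescale k c0 (B w)).
  move=> t t0 /=; apply: measurable_funM => //; apply: hB.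
  by rewrite mulr_ge0 // ltW.
have law : same_path_law P P0 (fun w => rescale k c0 (B w)) B0.
  move=> U mU; rewrite -(self_similar_path_law c0 mU) -kb.
  exact: (same_path_law_comp (measurable_rescale k c0) ((same_path_lawP _ _ _ _).1 BB0)).
split.
- split; first exact: filtration_rescale.
    exact: (@adapted_rescale _ _ _ F (fun w t => X w t) lam^-1 c c0 FX).
  exact: (@adapted_rescale _ _ _ F (fun w t => B w t) k c c0 FB).
- apply: filterS XB => w XB /=.
  exact: (@solves_rescale _ cp cm alpha lam c e k _ _ lam0 cE ke XB).
- exact/(same_path_lawP _ _ (fun w => rescale k c0 (B w)) B0).
- by move=> /levyB; exact: F_levy_rescale.
- move=> H fH; have HE := fractional_self_similar_index fH.
  have [fB [W [FW WB]]] := fbmB H fH; split.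
    exact: (fractional_brownian_law hkB hB0 law fH).
  exists (fun w t => (Num.sqrt c)^-1 * W w (c * t)); split.
    exact: F_brownian_rescale.
  move=> t t0; have ct0 : 0 <= c * t by rewrite mulr_ge0 // ltW.
  have [FWa _ _ _ _] := FW.
  have := @is_wiener_integral_rescale R _ _ P W t c (Num.sqrt c)^-1 (c `^ (1 / 2 - H))
    (volterra_kernel H (c * t)) (volterra_kernel H t) (fun w => B w (c * t)) c0 t0
    (adapted_measurable FF FWa) (hB _ ct0) (powR_gt0 _ c0) _ (WB _ ct0).
  rewrite (_ : c `^ (1 / 2 - H) / Num.sqrt c = k); last first.
    rewrite kb -HE -powR12_sqrt ?(ltW c0) // -powRN -powRD; last first.
      by rewrite (gt_eqF c0) implybT.
    by congr (_ `^ _); field.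
  apply => u ut.
  rewrite volterra_kernel_dilation // mulrA -powRD; last by rewrite (gt_eqF c0) implybT.
  by rewrite (_ : _ + _ = 0) ?powRr0 ?mul1r //; field.
Qed.

End self_similarity.

(** * Convergence to the extremal solutions *)

Section skorokhod_limits.
Variables (R : realType) (gam : R).
Hypothesis gam0 : 0 < gam.

Lemma cvg_skorokhod_uniform (I : Type) (F : set_system I) {FF : Filter F}
    (f_ : I -> skorokhod R) (f : skorokhod R) :
  (forall M e, 0 < e -> \forall i \near F, forall t, 0 <= t <= M -> `|f_ i t - f t| < e) ->
  f_ i @[i --> F] --> f.
Proof.
move=> H U; rewrite nbhsE => -[V [oV Vf] VU].
have [M [e [e0 MV]]] := oV f Vf.
apply: filterS (H M e e0) => i fi; apply/VU/MV.
exists idfun; split=> //.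
- split; last by move=> x y _ _.
  split; [by move=> x | by move=> x y | by move=> y y0; exists y].
- by move=> s _; rewrite subrr normr0.
Qed.

Lemma power_fun_cadlag (l : R) : cadlag (fun t : R => if t < 0 then 0 else l * t `^ gam).
Proof.
have cont t : 0 < t -> {for t, continuous (fun t : R => if t < 0 then 0 else l * t `^ gam)}.
  move=> t0; have : l * u `^ gam @[u --> t] --> l * t `^ gam.
    by apply: cvgMr; exact: powR_continuous.
  have ft : (if t < 0 then 0 else l * t `^ gam) = l * t `^ gam by rewrite ltNge (ltW t0).
  rewrite /prop_for /continuous_at /= ft; apply: cvg_trans.
  apply: near_eq_cvg; near=> u.
  have u0 : 0 < u by near: u; exact: lt_nbhsr.
  by rewrite ltNge (ltW u0).
split=> t t0; last first.
  by apply/cvg_ex; eexists; apply: cvg_at_left_filter; exact: cont.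
have [t_gt0|] := ltP 0 t; first by apply: cvg_at_right_filter; exact: cont.
move=> t_le0; have -> : t = 0 by apply/le_anti; rewrite t_le0.
rewrite ltxx powR0 ?gt_eqF // mulr0.
have : l * u `^ gam @[u --> 0^'+] --> l * 0 by apply: cvgMr; exact: powR_cvg0.
rewrite mulr0; apply: cvg_trans; apply: near_eq_cvg; near=> u.
have u0 : 0 < u by near: u; exact: nbhs_right_gt.
by rewrite ltNge (ltW u0).
Unshelve. all: by end_near.
Qed.

Lemma power_fun_neg (l t : R) : t < 0 -> (if t < 0 then 0 else l * t `^ gam) = 0.
Proof. by move=> ->. Qed.

Definition power_path (l : R) : skorokhod R :=
  Skorokhod (power_fun_cadlag l) (power_fun_neg l).

Lemma power_pathE l t : 0 <= t -> power_path l t = l * t `^ gam.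
Proof. by move=> t0 /=; rewrite ltNge t0. Qed.

Context d (T : measurableType d).

(** By right-continuity, a lower bound at the rational times after [N] holds at
    all times after [N]. *)
Lemma measurable_cvg_pinfty (x : T -> R -> R) :
  (forall t, 0 <= t -> measurable_fun setT (fun w => x w t)) ->
  (forall w t, 0 <= t -> x w s @[s --> t^'+] --> x w t) ->
  measurable [set w | x w t @[t --> +oo] --> +oo].
Proof.
move=> mx xr.
pose S (K N : nat) (q : rat) : set T :=
  if 0 <= (ratr q : R) then [set w | K%:R <= x w (N%:R + ratr q)] else setT.
have SE K N : \bigcap_q S K N q = [set w | forall t, N%:R <= t -> K%:R <= x w t].
  apply/seteqP; split=> w /=.
    move=> Sw t Nt; rewrite leNgt; apply/negP => xK.
    have t0 : 0 <= t by exact: le_trans Nt.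
    have e0 : 0 < K%:R - x w t by rewrite subr_gt0.
    have [r r0 rP] := cvg_at_right_ltP (xr w t t0) e0.
    have [q] : exists q, ratr q \in `]t - N%:R, t - N%:R + r[.
      by apply: rat_in_itvoo; rewrite ltrDl.
    rewrite in_itv /= => /andP[q1 q2].
    have q0 : 0 <= ratr q :> R by rewrite (le_trans _ (ltW q1)) // subr_ge0.
    have tq : t < N%:R + ratr q < t + r.
      by rewrite addrC -ltrBlDr q1 /= -ltrBrDr addrAC.
    have := rP _ tq; rewrite ltr_norml => /andP[_].
    rewrite ltrD2r ltNge => /negP; apply.
    by have := Sw q Logic.I; rewrite /S q0.
  move=> xw q _; rewrite /S; case: ifP => //= q0.
  by apply: xw; rewrite lerDl.
rewrite (_ : mkset _ = \bigcap_K \bigcup_N \bigcap_q S K N q).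
  apply: bigcap_measurable => // K _; apply: bigcup_measurable => N _.
  rewrite -[X in measurable X]setCK setC_bigcap; apply: measurableC.
  apply: bigcupT_measurable_rat => q; apply: measurableC; rewrite /S; case: ifP => // q0.
  rewrite (_ : mkset _ = setT `&` (fun w => x w (N%:R + ratr q)) @^-1` `[K%:R, +oo[%classic).
    by apply: mx => //; rewrite addr_ge0.
  by apply/seteqP; split=> w /=; rewrite in_itv /= andbT // => -[].
apply/seteqP; split=> w /=.
  move=> /cvg_pinftyP xw K _; have [M MP] := xw K%:R.
  have [N /andP[MN _]] := nat_ceil_ex (normr_ge0 M).
  exists N => //; rewrite SE /= => t Nt; apply: MP.
  by rewrite (le_trans (ler_norm M)) // (le_trans MN).
move=> xw; apply/cvg_pinftyP => K.
have [k /andP[Kk _]] := nat_ceil_ex (normr_ge0 K).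
have [N _] := xw k Logic.I; rewrite SE /= => xN; exists N%:R => t /xN.
by apply: le_trans; rewrite (le_trans (ler_norm K)).
Qed.

End skorokhod_limits.

Lemma coordinate_sets_pullback (R : realType) (I I' : Type) (k : I' -> I) (C : set (I' -> R)) :
  <<s @coordinate_sets I' R >> C ->
  <<s @coordinate_sets I R >> [set y | C (fun i => y (k i))].
Proof.
move=> mC.
suff : image_set_system setT (fun (y : I -> R) i => y (k i)) <<s @coordinate_sets I R >> C.
  by rewrite /image_set_system /= setTI.
move: C mC; apply: smallest_sub.
  exact/sigma_algebra_image/smallest_sigma_algebra.
move=> _ [i [A [mA ->]]]; rewrite /image_set_system /= setTI.
by apply: sub_sigma_algebra; exists (k i), A.
Qed.

Lemma rescaleK (R : realType) (a c : R) (c0 : 0 < c) (cV0 : 0 < c^-1) (f : skorokhod R) :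
  a != 0 -> rescale a cV0 (rescale a^-1 c0 f) = f.
Proof.
by move=> a0; apply: skorokhod_ext => t /=; rewrite mulrA divff // mul1r mulVKf ?gt_eqF.
Qed.

(** By self-similarity, the solution with noise of size [e] is, in law, the
    solution with noise of size 1 seen at scale [lam] in space. *)
Lemma expectation_small_noise (R : realType) (cp cm alpha beta e lam : R)
    (d0 : measure_display) (T0 : measurableType d0) (P0 : probability T0 R)
    (B0 : T0 -> skorokhod R)
    (d : measure_display) (T : measurableType d) (P : probability T R)
    (F : R -> set_system T) (X B : T -> skorokhod R)
    (d' : measure_display) (T' : measurableType d') (P' : probability T' R)
    (F' : R -> set_system T') (X' B' : T' -> skorokhod R)
    (cV0 : 0 < (lam `^ (1 - alpha))^-1) (G : skorokhod R -> R) :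
  process B0 -> self_similar P0 beta B0 ->
  0 < lam -> (lam `^ (1 - alpha)) `^ (- beta) = lam^-1 * e ->
  weak_uniqueness cp cm alpha 1 P0 B0 ->
  weak_solution cp cm alpha 1 P0 B0 P F X B ->
  weak_solution cp cm alpha e P0 B0 P' F' X' B' ->
  continuous G ->
  ('E_P'[G \o X'] = 'E_P[fun w => G (rescale lam cV0 (X w))])%E.
Proof.
move=> hB0 hself lam0 elam huniq hX hX' cG.
have c0 : 0 < lam `^ (1 - alpha) by rewrite powR_gt0.
have hZ := weak_solution_rescale hB0 hself c0 lam0 erefl erefl elam hX'.
have law : same_path_law P' P (fun w => rescale lam^-1 c0 (X' w)) X.
  apply/same_path_lawP => C mC.
  have := huniq _ _ _ _ _ _ _ _ _ _ _ _ hZ hX.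
  move=> /(_ [set y | C (fun t => y (inl t))]); apply.
  exact: coordinate_sets_pullback.
have proc (d1 : measure_display) (T1 : measurableType d1) (P1 : probability T1 R)
    (F1 : R -> set_system T1) (e1 : R) (X1 B1 : T1 -> skorokhod R) :
    weak_solution cp cm alpha e1 P0 B0 P1 F1 X1 B1 ->
    measurable_fun setT (X1 : T1 -> path_space R).
  move=> [[FF FX _] _ _ _ _]; apply: process_measurable.
  exact: (@adapted_measurable _ _ _ _ (fun w t => X1 w t) FF FX).
have mpsi : measurable_fun setT (G \o rescale lam cV0 : path_space R -> R).
  apply: (measurableT_comp (measurable_continuous_functional cG)).
  exact: measurable_rescale.
rewrite -(expectation_path_law (proc _ _ _ _ _ _ _ hZ) (proc _ _ _ _ _ _ _ hX) mpsi law).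
congr expectation; apply/funext => w /=.
by rewrite rescaleK // gt_eqF.
Qed.

Theorem theorem1p1 (R : realType) (cp cm alpha beta : R)
    (hcp : 0 < cp) (hcm : 0 < cm) (hbeta : 0 < beta)
    (halpha : 1 < alpha + beta^-1)
    (d0 : measure_display) (T0 : measurableType d0) (P0 : probability T0 R)
    (B0 : T0 -> skorokhod R) (hB0 : process B0)
    (hself : self_similar P0 beta B0)
    (d : measure_display) (T : measurableType d) (P : probability T R)
    (F : R -> set_system T) (X B : T -> skorokhod R)
    (hX : weak_solution cp cm alpha 1 P0 B0 P F X B)
    (huniq : weak_uniqueness cp cm alpha 1 P0 B0)
    (hinfty : {ae P, forall w, `|X w t| @[t --> +oo] --> +oo})
    (hnoise :
      (0 < alpha < 1 /\
       exists (h : R -> R) (tn : nat -> T -> R),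
         [/\ littleo_pinfty h (fun t => t `^ (1 - alpha)^-1),
             forall n, measurable_fun setT (tn n) &
             {ae P, forall w,
               [/\ forall n, 0 <= tn n w,
                   tn n w @[n --> \oo] --> +oo &
                   forall n t, tn n w <= t ->
                     `|B w t - B w (tn n w)| <= h (t - tn n w)]}])
      \/
      (-1 < alpha <= 0 /\
       {ae P, forall w,
         littleo_pinfty (B w) (fun t => t `^ (1 - alpha)^-1)}))
    (d' : R -> measure_display) (T' : forall e : R, measurableType (d' e))
    (P' : forall e : R, probability (T' e) R)
    (F' : forall e : R, R -> set_system (T' e))
    (X' B' : forall e : R, T' e -> skorokhod R)
    (hX' : forall e : R, 0 < e ->
       weak_solution cp cm alpha e P0 B0 (P' e) (F' e) (X' e) (B' e)) :
  exists Y : T -> skorokhod R,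
    (forall w t, 0 <= t ->
       Y w t = ((1 - alpha) * t) `^ (1 - alpha)^-1 *
         (cp `^ (1 - alpha)^-1 * \1_[set v | X v s @[s --> +oo] --> +oo] w -
          cm `^ (1 - alpha)^-1 * \1_[set v | X v s @[s --> +oo] --> -oo] w)) /\
    weak_cvg_at0 P' X' P Y.
Proof.
have alpha1 : alpha < 1 by case: hnoise => -[/andP[a0 a1] _] //; exact: le_lt_trans ltr01.
set gam := (1 - alpha)^-1.
have gam0 : 0 < gam by rewrite invr_gt0 subr_gt0.
pose Y w := power_path gam0 (limit_coef alpha cp cm (X w)).
exists Y; split.
  move=> w t t0; rewrite power_pathE // powRM //; last by rewrite subr_ge0 ltW.
  rewrite /limit_coef /extremal_coef !powRM ?(ltW hcp) ?(ltW hcm) ?subr_ge0 ?(ltW alpha1) //.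
  rewrite !indicE.
  have -> : (w \in [set v | X v s @[s --> +oo] --> +oo]) = `[< X w s @[s --> +oo] --> +oo >] by [].
  have -> : (w \in [set v | X v s @[s --> +oo] --> -oo]) = `[< X w s @[s --> +oo] --> -oo >] by [].
  by rewrite -/gam; ring.
move=> G cG bG.
have [M GM] : exists M, forall x, `|G x| <= M.
  have [K [_ KP]] := bG; exists (K + 1) => x.
  by apply: (KP (K + 1)) => //; rewrite ltrDl.
(* [lam e] is the scale of space for which [elam] below holds; it tends to 0
   with [e] because [kap] is positive. *)
pose kap := 1 - (1 - alpha) * beta.
have kap0 : 0 < kap.
  rewrite subr_gt0 -ltr_pdivlMr // mul1r.
  by rewrite ltrBlDl.
pose lam e := e `^ kap^-1.
have lam_gt0 e : 0 < e -> 0 < lam e by move=> e0; rewrite powR_gt0.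
have c_gt0 e : 0 < e -> 0 < (lam e `^ (1 - alpha))^-1.
  by move=> e0; rewrite invr_gt0 powR_gt0 // lam_gt0.
have elam e : 0 < e -> (lam e `^ (1 - alpha)) `^ (- beta) = (lam e)^-1 * e.
  move=> e0; have le := lam_gt0 e e0.
  have {3}-> : e = lam e `^ kap by rewrite /lam -powRrM mulVf ?gt_eqF // powRr1 // ltW.
  rewrite -powRrM -[(lam e)^-1]powR_inv1 ?(ltW le) // -powRD; last first.
    by rewrite (gt_eqF le) implybT.
  by congr (_ `^ _); rewrite /kap; ring.
have EG e (e0 : 0 < e) : ('E_(P' e)[G \o X' e] =
    'E_P[fun w => G (rescale (lam e) (c_gt0 e e0) (X w))])%E.
  exact: (expectation_small_noise _ hB0 hself (lam_gt0 e e0) (elam e e0) huniq hX (hX' e e0) cG).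
have [[FF FX _] XB _ _ _] := hX.
have mXt t : 0 <= t -> measurable_fun setT (fun w => X w t).
  exact: (@adapted_measurable _ _ _ _ (fun w t => X w t) FF FX).
have mX : measurable_fun setT (X : T -> path_space R) by exact: process_measurable.
have mG := measurable_continuous_functional cG.
have mGZ e (e0 : 0 < e) : measurable_fun setT
    (fun w => (G (rescale (lam e) (c_gt0 e e0) (X w)))%:E).
  apply/measurable_EFinP.
  exact: (measurableT_comp mG (measurableT_comp (measurable_rescale _ _) mX)).
pose Up := [set w | X w s @[s --> +oo] --> +oo].
pose Um := [set w | X w s @[s --> +oo] --> -oo].
have mUp : measurable Up.
  apply: measurable_cvg_pinfty => // w t t0.
  exact: (skorokhod_cadlag (X w)).1.
have mUm : measurable Um.
  rewrite (_ : Um = [set w | (- X w s) @[s --> +oo] --> +oo]).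
    apply: (@measurable_cvg_pinfty _ _ _ (fun w t => - X w t)) => [t t0|w t t0].
      by apply: measurableT_comp => //; exact: mXt.
    by apply: cvgN; exact: (skorokhod_cadlag (X w)).1.
  by apply/seteqP; split=> w /=; rewrite -cvgNrNy opprK.
(* [Y] takes finitely many values, on events determined by [Up] and [Um]. *)
have mGY : measurable_fun setT (fun w => (G (Y w))%:E).
  pose q w := (`[< Up w >], `[< Um w >]).
  pose GY (b : bool * bool) := (G (power_path gam0
    (extremal_coef alpha cp * b.1%:R - extremal_coef alpha cm * b.2%:R)))%:E.
  rewrite -[fun w => _]/(GY \o q); apply: measurable_countable_comp => -[b1 b2].
  have mb (U : set T) (b : bool) : measurable U -> measurable [set w | `[< U w >] = b].
    move=> mU; case: b.
      by rewrite (_ : mkset _ = U) //; apply/seteqP; split=> w /= /asboolP.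
    rewrite (_ : mkset _ = ~` U); first exact: measurableC.
    by apply/seteqP; split=> w /= => [wU|]; [apply/asboolPn; rewrite wU|exact: asboolF].
  rewrite (_ : mkset _ = [set w | `[< Up w >] = b1] `&` [set w | `[< Um w >] = b2]).
    by apply: measurableI; exact: mb.
  by apply/seteqP; split=> w /=; rewrite /q; [case|case=> -> ->].
have cvgGZ : {ae P, forall w, forall u : nat -> R, (forall n, 0 < u n) ->
    u n @[n --> \oo] --> 0 -> forall uV : (forall n, 0 < (lam (u n) `^ (1 - alpha))^-1),
    G (rescale (lam (u n)) (uV n) (X w)) @[n --> \oo] --> G (Y w)}.
  have noise : {ae P, forall w, admissible_noise alpha (B w)}.
    case: hnoise => [[al01 [h [tn [hlo _ tnP]]]]|[al01 blo]].
      apply: filterS tnP => w [_ tny bh]; left; split=> //.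
      by exists h, (tn ^~ w).
    by apply: filterS blo => w blo; right.
  apply: filterS3 XB hinfty noise => w xb xy bn u u0 u_to0 uV.
  have xa := path_asymptotics alpha1 hcp hcm (skorokhod_cadlag (X w)) xb xy bn.
  apply: (@cvg_comp _ _ _ (fun n => rescale (lam (u n)) (uV n) (X w)) G _ (nbhs (Y w)));
    last exact: cG.
  apply: cvg_skorokhod_uniform => K e e0.
  have [lam0 lam00 lamP] := asymptotic_to_rescaled alpha1 K (skorokhod_cadlag (X w)) xa e0.
  have /cvgrPdist_lt /(_ (lam0 `^ kap) (powR_gt0 _ lam00)) := u_to0.
  apply: filterS => n; rewrite sub0r normrN (gtr0_norm (u0 n)) => un t /andP[t0 tK].
  rewrite power_pathE //=; apply: lamP; last by rewrite t0.
  rewrite lam_gt0 //= /lam.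
  have <- : (lam0 `^ kap) `^ kap^-1 = lam0.
    by rewrite -powRrM divff ?gt_eqF // powRr1 // ltW.
  by rewrite gt0_ltr_powR ?invr_gt0 ?nnegrE ?powR_ge0 // ltW.
have iM : P.-integrable setT (EFin \o cst M) by exact: finite_measure_integrable_cst.
have fin (H : T -> R) : (forall w, `|H w| <= M) -> measurable_fun setT (EFin \o H) ->
    'E_P[H]%E \is a fin_num.
  move=> HM mH; rewrite unlock; apply: integrable_fin_num => //.
  apply: (le_integrable measurableT mH _ iM) => w _.
  by rewrite /= lee_fin (le_trans (HM w)) // ler_norm.
have finY : 'E_P[G \o Y]%E \is a fin_num.
  by apply: (fin (G \o Y)) => // w; exact: GM.
rewrite -(fineK finY); apply/fine_cvgP; split.
  near=> e; have e0 : 0 < e by near: e; exact: nbhs_right_gt.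
  by rewrite (EG e e0); apply: fin; [move=> w; exact: GM | exact: mGZ].
apply/cvg_at_rightP => u [u0 u_to0].
have EGu : (fun n => (fine \o (fun e => 'E_(P' e)[G \o X' e])%E) (u n)) =
    (fun n => fine (\int[P]_w (G (rescale (lam (u n)) (c_gt0 _ (u0 n)) (X w)))%:E)%E).
  by apply/funext => n /=; rewrite (EG _ (u0 n)) unlock.
rewrite EGu; apply: fine_cvg; rewrite (fineK finY) unlock.
pose GZ n w := (G (rescale (lam (u n)) (c_gt0 _ (u0 n)) (X w)))%:E.
have GZ_cvg : {ae P, forall w, setT w -> GZ ^~ w @ \oo --> (G (Y w))%:E}.
  apply: filterS cvgGZ => w H _; apply: cvg_EFin; first exact: nearW.
  exact: (H u u0 u_to0 (fun n => c_gt0 _ (u0 n))).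
have GZ_le : {ae P, forall w n, setT w -> (`|GZ n w| <= (EFin \o cst M) w)%E}.
  by apply: aeW => w n _; rewrite /= lee_fin; exact: GM.
by have [] := dominated_convergence measurableT (fun n => mGZ _ (u0 n)) mGY GZ_cvg iM GZ_le.
Unshelve. all: by end_near.
Qed.
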